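(* Let $X$ be a random vector in a separable Hilbert space $H$ and let $(X_1,\dots,X_n)$ be a sample made of $n$ independent copies of $X$. Let $\mathcal{B}=\{x\in H:\lVert x\rVert\le B\}$ be the ball of radius $B$, and assume that $\mathbb{P}(X\in\mathcal{B})=1$, $n\ge 2k$ and $k\ge 2$. (1) For any $\delta\in(0,1)$, with probability at least $1-\delta$, $$\sup_{c\in\mathcal{B}^k}\bigl(\mathbb{P}_X-\overline{\mathbb{P}}_X\bigr)\Bigl(\min_{1\le j\le k}\bigl(\lVert c_j\rVert^2-2\langle c_j,X\rangle\bigr)\Bigr)$$ $$\le B^2\log\Bigl(\frac nk\Bigr)\sqrt{\frac{k\log k}{n}}\Biggl(\frac{6\sqrt2}{\log 2}+\frac{6}{\log(n/k)}+\frac{1}{\log(n/k)}\sqrt{\frac{2(\sqrt2+1)(17+9\log k)}{\log k}}\Biggr)+2B^2\sqrt{\frac{2\log(\delta^{-1})}{n}}$$ $$\le 16B^2\log\Bigl(\frac nk\Bigr)\sqrt{\frac{k\log k}{n}}+2B^2\sqrt{\frac{2\log(\delta^{-1})}{n}},$$ where $6\sqrt2/\log 2\le 12.3$. (2) For any $c^*\in\mathcal{B}^k$ and any $\delta\in(0,1)$, with probability at least $1-\delta$, $$\sup_{c\in\mathcal{B}^k}\bigl(\mathbb{P}_X-\overline{\mathbb{P}}_X\bigr)\Bigl[\Bigl(\min_{1\le j\le k}\lVert X-c_j\rVert^2\Bigr)-\Bigl(\min_{1\le j\le k}\lVert X-c^*_j\rVert^2\Bigr)\Bigr]\le 16B^2\log\Bigl(\frac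 nk\Bigr)\sqrt{\frac{k\log k}{n}}+4B^2\sqrt{\frac{2\log(\delta^{-1})}{n}}.$$ (3) Consequently, for any $\epsilon\ge 0$ and any $\epsilon$-minimizer $\widehat c$, that is, any $\widehat c\in\mathcal{B}^k$ depending on the observed sample and satisfying $$\overline{\mathbb{P}}_X\Bigl(\min_{1\le j\le k}\lVert X-\widehat c_j\rVert^2\Bigr)\le\inf_{c\in H^k}\overline{\mathbb{P}}_X\Bigl(\min_{1\le j\le k}\lVert X-c_j\rVert^2\Bigr)+\epsilon,$$ for any $\delta\in(0,1)$, with probability at least $1-\delta$, $$\mathbb{P}_X\Bigl(\min_{1\le j\le k}\lVert X-\widehat c_j\rVert^2\Bigr)\le\inf_{c\in H^k}\mathbb{P}_X\Bigl(\min_{1\le j\le k}\lVert X-c_j\rVert^2\Bigr)+16B^2\log\Bigl(\frac nk\Bigr)\sqrt{\frac{k\log k}{n}}+4B^2\sqrt{\frac{2\log(\delta^{-1})}{n}}+\epsilon.$$ (4) Moreover, in expectation with respect to the sample distribution, for such a $\widehat c$, $$\mathbb{P}_{X_1,\dots,X_n}\Bigl[\mathbb{P}_X\Bigl(\min_{1\le j\le k}\lVert X-\widehat c_j\rVert^2\Bigr)\Bigr]\le\inf_{c\in H^k}\mathbb{P}_X\Bigl(\min_{1\le j\le k}\lVert X-c_j\rVert^2\Bigr)+16B^2\log\Bigl(\frac nk\Bigr)\sqrt{\frac{k\log k}{n}}+\epsilon.$$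
   Context: $\mathbb{P}_X$ denotes the law of $X$, and $\mathbb{P}_X(f(X))$ denotes the expectation of $f(X)$ under this law, i.e. the integral over an $X$ independent of the sample, with the sample (hence $\widehat c$) held fixed. $\overline{\mathbb{P}}_X=\frac1n\sum_{i=1}^n\delta_{X_i}$ is the empirical measure, so $\overline{\mathbb{P}}_X(f(X))=\frac1n\sum_{i=1}^n f(X_i)$. $\mathbb{P}_{X_1,\dots,X_n}[\cdot]$ is the expectation with respect to the sample. For $c\in H^k$, $c_1,\dots,c_k\in H$ are its components; $c^*\in\mathcal{B}^k$ in (2) is a non-random reference.
   Formalization: In (1) the second inequality of the chain is false as written (k=2, n=4, B>0: the bracket is about 39.3 > 16); instead both right-hand sides are shown to bound the supremum on one event, and bracket ≤ 16 is asserted only when 16 log(n/k) sqrt(k log k/n) ≤ 4. *)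

(* Defs.v *)
From HB Require Import structures.
From mathcomp Require Import all_boot all_order all_algebra.
From mathcomp Require Import sesquilinear.
From mathcomp Require Import all_classical all_reals all_analysis.

Set Implicit Arguments.
Unset Strict Implicit.
Unset Printing Implicit Defensive.

Import Order.TTheory GRing.Theory Num.Theory.
Import numFieldNormedType.Exports.

Local Open Scope classical_set_scope.
Local Open Scope ring_scope.

(* A real Hilbert space is a complete normed module whose norm is induced by
   an inner product. *)
Definition norm_induced_by (R : realType) (H : completeNormedModType R)
  (ip : {dot H for idfun}) : Prop := forall x : H, ip x x = `|x| ^+ 2.

Definition separable (T : topologicalType) : Prop :=
  exists2 D : set T, countable D & dense D.

(* [H] with its Borel sigma-algebra; convertible to [H] as a type. *)
Definition borel (H : ptopologicalType) := g_sigma_algebraType (@open H).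

Section probability_notions.
Context (d d' : measure_display) (Omega : measurableType d)
  (T : measurableType d') (R : realType) (P : probability Omega R).

Definition mutually_independent n (Xs : 'I_n -> {RV P >-> T}) : Prop :=
  forall (J : {set 'I_n}) (A : 'I_n -> set T),
    (forall i, measurable (A i)) ->
    P (\bigcap_(i in [set i | i \in J]) (Xs i @^-1` A i)) =
    (\prod_(i in J) P (Xs i @^-1` A i))%E.

Definition identically_distributed (X Y : {RV P >-> T}) : Prop :=
  forall A, measurable A -> distribution P X A = distribution P Y A.

Definition independent_copies n (X : {RV P >-> T}) (Xs : 'I_n -> {RV P >-> T})
  : Prop :=
  mutually_independent Xs /\ (forall i, identically_distributed (Xs i) X).

(* "With probability at least [p], [A] holds". For a measurable [A] this is
   [p <= P A]; the inner event gives a meaning to the phrase when [A] is not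
   known to be measurable. *)
Definition with_probability_ge (p : R) (A : set Omega) : Prop :=
  exists E : set Omega, [/\ measurable E, E `<=` A & (p%:E <= P E)%E].

End probability_notions.

(* The minimum of a finite family; the value 0 on the empty family is
   arbitrary. *)
Definition min_family (R : realType) (k : nat) : ('I_k -> R) -> R :=
  match k return ('I_k -> R) -> R with
  | 0 => fun _ => 0
  | k'.+1 => fun F => \big[Num.min/F ord0]_(j < k'.+1) F j
  end.

Section quantization.
Context (R : realType) (H : completeNormedModType R).

Definition ball_tuples (k : nat) (B : R) : set ('I_k -> H) :=
  [set c | forall j, `|c j| <= B].

Definition linear_loss (ip : {dot H for idfun}) k (c : 'I_k -> H) (x : H) : R :=
  min_family (fun j => `|c j| ^+ 2 - 2 * ip (c j) x).

Definition quadratic_loss k (c : 'I_k -> H) (x : H) : R :=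
  min_family (fun j => `|x - c j| ^+ 2).

Definition population_mean (mu : probability (borel H) R) (f : H -> R)
  : \bar R := (\int[mu]_x (f x)%:E)%E.

(* The integral of [f] under the empirical measure of the points [x]. *)
Definition empirical_mean n (x : 'I_n -> H) (f : H -> R) : R :=
  n%:R^-1 * \sum_(i < n) f (x i).

Definition mean_gap (mu : probability (borel H) R) n (x : 'I_n -> H)
  (f : H -> R) : \bar R :=
  (population_mean mu f - (empirical_mean x f)%:E)%E.

End quantization.

Arguments ball_tuples {R H} k B _.

Section bounds.
Context (R : realType).
Implicit Types (B delta : R) (n k : nat).

Definition rate n k : R :=
  ln (n%:R / k%:R) * Num.sqrt (k%:R * ln k%:R / n%:R).

Definition sharp_factor n k : R :=
  6 * Num.sqrt 2 / ln 2 + 6 / ln (n%:R / k%:R)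
  + (ln (n%:R / k%:R))^-1
    * Num.sqrt (2 * (Num.sqrt 2 + 1) * (17 + 9 * ln k%:R) / ln k%:R).

Definition deviation n delta : R := Num.sqrt (2 * ln (delta^-1) / n%:R).

End bounds.

(* Main.v *)
Require Import Defs.
From HB Require Import structures.
From mathcomp Require Import all_boot all_order all_algebra.
From mathcomp Require Import sesquilinear.
From mathcomp Require Import all_classical all_reals all_analysis.
From mathcomp Require Import measurable_realfun.
From mathcomp Require Import ring lra.

(** The heart of the matter is the bound on the mean of the supremum over
    [c] of the deviation between the law and the sample; the deviation terms then
    follow from McDiarmid's inequality, because one observation moves the supremum
    by at most the oscillation of the losses divided by [n].

    Everything is first reduced to finitely many points ([quantizer],
    [finite_approximation]): a separable space is covered, up to a set of small
    mass, by finitely many small cells, and moving the observations and the law to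
    one point per cell changes all deviations by an error that is small in mean,
    since the losses are Lipschitz on the ball uniformly in [c].  After that the
    law of the sample is a product of weights, expectations are finite sums, and
    suprema over [c] raise no question of measurability.  The error disappears in
    the limit ([with_probability_ge_limit]).

    For a finitely supported law the loss [`|c j| ^+ 2 - 2 * ip (c j) x], suitably
    shifted, is a minimum over [j] of functions linear in vectors [v j] of norm at
    most [sqrt (5 / 4)] ([mean_gap_linear_le]).  These vectors are replaced by
    random ones: every coordinate becomes a sign times a scale [s], biased to keep
    the mean, which imitates a Gaussian perturbation of standard deviation [s] when
    the coordinates are small.  The relative entropy with respect to unbiased signs
    is at most of order [k / s ^+ 2] ([level_entropy_le]), and the perturbation of
    the minimum over [j] has a second moment of order [s ^+ 2 * ln k]
    ([mean_sqr_max_le]), in any dimension.  The PAC-Bayesian inequality [pac_bayes]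
    bounds the mean of a deviation chosen after the sample by the square root of
    entropy times second moment divided by [n].  Applied to two consecutive scales
    [s] and [3 * s] it gives a multiple of [sqrt (k * ln k / n)], whatever [s]
    ([chain_link_le]); about [ln (n / k) / ln 9] scales lead from [1] to
    [sqrt (k / n)], where the perturbation is negligible.  This yields the factor
    [ln (n / k)], and [chain_bound_le_rate] compares the constants.

    The statements on quadratic losses follow from
    [quadratic_loss c x = `|x| ^+ 2 + linear_loss ip c x].  For a minimizer of the
    empirical risk, the loss of a near minimizer of the risk is subtracted; it may
    be taken in the ball because projecting the centres on the ball does not
    increase the loss at points of the ball ([quadratic_loss_clip]). *)

Set Implicit Arguments.
Unset Strict Implicit.
Unset Printing Implicit Defensive.

Import Order.TTheory GRing.Theory Num.Theory.
Import numFieldNormedType.Exports.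

Local Open Scope classical_set_scope.
Local Open Scope ring_scope.

(** * Calculus inequalities *)

Section calculus.
Context (R : realType).
Implicit Types (f df : R -> R) (x y l m : R).

Lemma mean_value_from0 f df x :
  (forall t : R, 0 <= t <= 1 -> is_derive (t * x) 1 f (df (t * x))) ->
  exists2 t, 0 <= t <= 1 & f x - f 0 = df (t * x) * x.
Proof.
move=> fdf.
have dfP z : 0 <= z * x -> z ^+ 2 <= x ^+ 2 -> is_derive z 1 f (df z).
  have [->|x0] := eqVneq x 0.
    rewrite expr0n/= => _ z2.
    have /eqP : z ^+ 2 = 0 by apply/le_anti; rewrite z2 sqr_ge0.
    rewrite sqrf_eq0 => /eqP ->.
    by have := fdf 0; rewrite mul0r; apply; rewrite lexx ler01.
  move=> zx zz; rewrite -(divfK x0 z); apply: fdf.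
  have x2 : 0 < x ^+ 2 by rewrite exprn_even_gt0.
  have e : z / x = z * x / x ^+ 2 by field.
  rewrite e; apply/andP; split; first by rewrite divr_ge0// ltW.
  rewrite ler_pdivrMr// mul1r -ler_sqr ?nnegrE ?sqr_ge0//.
  by rewrite exprMn [X in _ <= X]expr2 ler_wpM2r// ltW.
have fc z : 0 <= z * x -> z ^+ 2 <= x ^+ 2 -> {for z, continuous f}.
  move=> z1 z2; apply: differentiable_continuous; apply/derivable1_diffP.
  by have [] := dfP _ z1 z2.
have [x0|x0|->] := ltgtP x 0.
- have [||c] := @MVT_segment R f df x 0 (ltW x0).
  + by move=> z /[!in_itv]/= /andP[? ?]; apply: dfP; nra.
  + apply: continuous_in_subspaceT => z /[!inE]/= /[!in_itv]/= /andP[? ?].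
    by apply: fc; nra.
  + move=> /[!in_itv]/= /andP[c1 c2] e; exists (c / x).
      by rewrite ler_ndivrMr// mul1r c1 andbT mulr_le0// invr_le0 ltW.
    by rewrite divfK ?lt_eqF//; lra.
- have [||c] := @MVT_segment R f df 0 x (ltW x0).
  + by move=> z /[!in_itv]/= /andP[? ?]; apply: dfP; nra.
  + apply: continuous_in_subspaceT => z /[!inE]/= /[!in_itv]/= /andP[? ?].
    by apply: fc; nra.
  + move=> /[!in_itv]/= /andP[c1 c2] e; exists (c / x).
      by rewrite ler_pdivrMr// mul1r c2 andbT divr_ge0 // ltW.
    by rewrite divfK ?gt_eqF// e subr0.
- by exists 0; rewrite ?subrr ?mulr0// lexx ler01.
Qed.

(** A derivative with the sign of its argument makes [0] a minimum. *)
Lemma min_at0 f df x :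
  (forall t : R, 0 <= t <= 1 -> is_derive (t * x) 1 f (df (t * x))) ->
  (forall t : R, 0 <= t <= 1 -> 0 <= df (t * x) * x) ->
  f 0 <= f x.
Proof.
move=> /mean_value_from0[t t01 e] /(_ _ t01); rewrite -e.
by rewrite subr_ge0.
Qed.

(** The logarithm of the ratio of both sides has derivative
    [x ^+ 3 / (9 * (1 + x + x ^+ 2 / 3))], which has the sign of [x]. *)
Lemma expR_self_normalized x :
  expR (x - x ^+ 2 / 6) <= 1 + x + x ^+ 2 / 3.
Proof.
have q0 y : 0 < 1 + y + y ^+ 2 / 3 by have := sqr_ge0 (y + 3 / 2); lra.
pose f y := ln (1 + y + y ^+ 2 / 3) - (y - y ^+ 2 / 6).
pose df y := y ^+ 3 / (9 * (1 + y + y ^+ 2 / 3)).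
have dfE y : is_derive y 1 f (df y).
  have h : is_derive y 1 (fun z : R => 1 + z + z ^+ 2 / 3) (1 + 2 / 3 * y).
    by apply: is_derive_eq; rewrite ?scaler0 ?add0r ?addr0 /GRing.scale/=; ring.
  have h2 : is_derive y 1 (fun z : R => z - z ^+ 2 / 6) (1 - y / 3).
    by apply: is_derive_eq; rewrite ?scaler0 ?add0r ?addr0 /GRing.scale/=; field.
  have h3 := is_derive1_ln (q0 y).
  have h4 : is_derive y 1 (@ln R \o (fun z : R => 1 + z + z ^+ 2 / 3)) ((1 + 2 / 3 * y) / (1 + y + y ^+ 2 / 3)).
    by apply: is_derive_eq; rewrite mulrC.
  rewrite /f; apply: (@is_derive_eq _ _ _ _ _ _ _ _ (is_deriveB h4 h2)).
  by rewrite /df; have := q0 y => ?; field; rewrite !gt_eqF//; lra.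
have : f 0 <= f x.
  apply: (@min_at0 f df) => t /andP[t0 t1].
  rewrite /df.
  have e : (t * x) ^+ 3 / (9 * (1 + t * x + (t * x) ^+ 2 / 3)) * x
     = t ^+ 3 * (x ^+ 2) ^+ 2 / (9 * (1 + t * x + (t * x) ^+ 2 / 3)).
    by field; rewrite gt_eqF//; have := q0 (t * x); lra.
  rewrite e divr_ge0//; first by apply: mulr_ge0; [exact: exprn_ge0|exact: sqr_ge0].
  by rewrite mulr_ge0// ltW.
rewrite /f expr0n/= !mul0r !addr0 subr0 ln1 subrr subr_ge0 => h.
by rewrite -ler_ln ?posrE ?expR_gt0// expRK.
Qed.

(** The difference of both sides has derivative [x ^+ 3 / (1 + x)]. *)
Lemma ln1D_le_cubic x : -1 < x -> ln (1 + x) <= x - x ^+ 2 / 2 + x ^+ 3 / 3.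
Proof.
move=> x1.
pose f y := y - y ^+ 2 / 2 + y ^+ 3 / 3 - ln (1 + y).
pose df y := y ^+ 3 / (1 + y).
have q0 t : 0 <= t <= 1 -> 0 < 1 + t * x.
  move=> /andP[t0 t1]; have [x0|x0] := leP 0 x.
    by rewrite ltr_wpDr// mulr_ge0.
  have : 0 <= (1 - t) * - x by rewrite mulr_ge0; lra.
  lra.
have dfE y : 0 < 1 + y -> is_derive y 1 f (df y).
  move=> y0.
  have h : is_derive y 1 (fun z : R => z - z ^+ 2 / 2 + z ^+ 3 / 3) (1 - y + y ^+ 2).
    by apply: is_derive_eq; rewrite ?scaler0 ?add0r ?addr0 /GRing.scale/=; field.
  have h2 : is_derive y 1 (fun z : R => 1 + z) 1.
    by apply: is_derive_eq; rewrite add0r ?mulr1.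
  have h3 := is_derive1_ln y0.
  have h4 : is_derive y 1 (@ln R \o (fun z : R => 1 + z)) (1 + y)^-1.
    by apply: (is_derive_eq (is_derive1_comp h3 h2)); rewrite ?mulr1 ?mul1r.
  rewrite /f; apply: (@is_derive_eq _ _ _ _ _ _ _ _ (is_deriveB h h4)).
  by rewrite /df; field; rewrite gt_eqF.
have : f 0 <= f x.
  apply: (@min_at0 f df) => t t01; have := q0 _ t01 => q; first exact: dfE.
  rewrite /df mulrAC divr_ge0 ?(ltW q)//.
  case/andP: t01 => t0 t1.
  have -> : (t * x) ^+ 3 * x = t ^+ 3 * (x ^+ 2) ^+ 2 by ring.
  by apply: mulr_ge0; [exact: exprn_ge0|exact: sqr_ge0].
rewrite /f !expr0n/= !mul0r !addr0 !subr0 ln1; lra.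
Qed.

(** The left-hand side is the relative entropy of a sign of mean [m] with
    respect to a fair one; the leading term [m ^+ 2 / 2] is that of a Gaussian
    shift, which many small signs imitate. *)
Lemma sign_entropy_le m : -1 < m < 1 ->
  (1 + m) / 2 * ln (1 + m) + (1 - m) / 2 * ln (1 - m) <= m ^+ 2 / 2 + m ^+ 4 / 3.
Proof.
move=> /andP[m1 m2].
have h1 := ln1D_le_cubic m1.
have /ln1D_le_cubic h2 : -1 < - m by lra.
have a1 : 0 <= (1 + m) / 2 by lra.
have a2 : 0 <= (1 - m) / 2 by lra.
have := lerD (ler_wpM2l a1 h1) (ler_wpM2l a2 h2).
move/le_trans; apply.
by rewrite le_eqVlt; apply/orP; left; apply/eqP; field.
Qed.

(** Hoeffding's lemma for a centred sign of mean [m].  With [D] the left-hand side times [expR (l * m)], the function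
    [l ^+ 2 / 2 + l * m - ln D] vanishes at [0] together with its derivative,
    and its second derivative is the square [(D' / D) ^+ 2]. *)
Lemma sign_mgf_le m l : -1 <= m <= 1 ->
  (1 + m) / 2 * expR (l * (1 - m)) + (1 - m) / 2 * expR (l * (-1 - m))
    <= expR (l ^+ 2 / 2).
Proof.
move=> /andP[m1 m2].
pose D y := (1 + m) / 2 * expR y + (1 - m) / 2 * expR (- y).
pose D' y := (1 + m) / 2 * expR y - (1 - m) / 2 * expR (- y).
have D0 y : 0 < D y.
  rewrite /D; have := expR_gt0 y; have := expR_gt0 (- y) => h1 h2.
  have [?|?] := lerP 0 m; nra.
have eN y : is_derive y 1 (fun z : R => expR (- z)) (- expR (- y)).
  have h := is_deriveNid y 1.
  have h2 := is_derive_expR (- y).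
  by have := is_derive1_comp h2 h => /is_derive_eq; apply; rewrite mulrN1.
have dD y : is_derive y 1 D (D' y).
  by rewrite /D; apply: is_derive_eq; rewrite /GRing.scale/= /D'; ring.
have dD' y : is_derive y 1 D' (D y).
  by rewrite /D'; apply: is_derive_eq; rewrite /GRing.scale/= /D; ring.
have DI y : is_derive y 1 (fun z => (D z)^-1) (- D' y / D y ^+ 2).
  have hn : D y != 0 by rewrite gt_eqF.
  have h := is_deriveV hn (dD y).
  by apply: (is_derive_eq h); rewrite /GRing.scale/=; field.
pose q y := y + m - D' y / D y.
have dq y : is_derive y 1 q ((D' y / D y) ^+ 2).
  have h := is_deriveM (dD' y) (DI y).
  have h2 : is_derive y 1 (fun z : R => z + m) 1.
    by apply: is_derive_eq; rewrite addr0.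
  apply: (is_derive_eq (is_deriveB h2 h)).
  by rewrite /GRing.scale/=; field; rewrite gt_eqF.
have q_0 : q 0 = 0.
  by rewrite /q /D' /D oppr0 expR0 !mulr1; field; apply/eqP; lra.
pose f y := y ^+ 2 / 2 + y * m - ln (D y).
have df y : is_derive y 1 f (q y).
  have h3 := is_derive1_ln (D0 y).
  have h4 : is_derive y 1 (@ln R \o D) (D' y / D y).
    by apply: is_derive_eq; rewrite mulrC.
  have h2 : is_derive y 1 (fun z : R => z ^+ 2 / 2 + z * m) (y + m).
    by apply: is_derive_eq; rewrite ?scaler0 ?add0r ?addr0 /GRing.scale/=; field.
  by apply: (is_derive_eq (is_deriveB h2 h4)).
have : f 0 <= f l.
  apply: (@min_at0 f q) => t t01.
  have [s _] := @mean_value_from0 q (fun y => (D' y / D y) ^+ 2) (t * l) (fun s _ => dq _).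
  rewrite q_0 subr0 => ->; case/andP: t01 => t0 _.
  by rewrite -mulrA mulr_ge0 ?sqr_ge0// -mulrA mulr_ge0// -expr2 sqr_ge0.
rewrite /f expr0n/= !mul0r !addr0 /D oppr0 expR0 !mulr1.
have -> : (1 + m) / 2 + (1 - m) / 2 = 1 by field.
rewrite ln1 subr0 subr_ge0 => h.
have {}h : D l <= expR (l ^+ 2 / 2 + l * m).
  by rewrite -[leLHS]lnK ?posrE// ler_expR.
have -> : (1 + m) / 2 * expR (l * (1 - m)) + (1 - m) / 2 * expR (l * (-1 - m))
    = D l / expR (l * m).
  have -> : l * (1 - m) = l - l * m by ring.
  have -> : l * (-1 - m) = - l - l * m by ring.
  by rewrite !expRD [expR (- (l * m))]expRN /D; ring.
by rewrite ler_pdivrMr ?expR_gt0// -expRD.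
Qed.

(** The tangent at [u0], in the variable [expR u], of the square of the
    logarithm lies above it. *)
Lemma sqr_le_tangent (u0 u : R) : 2 <= u0 -> 0 <= u ->
  u ^+ 2 <= u0 ^+ 2 + 2 * u0 * (expR (u - u0) - 1).
Proof.
move=> u02 u0u; set v := u - u0.
have -> : u = u0 + v by rewrite /v; ring.
have {u0u} v0 : - u0 <= v by rewrite /v; lra.
have key : v ^+ 2 <= 2 * u0 * (expR v - 1 - v).
  have [v2|v2] := leP v (-2).
    by have := expR_gt0 v => h; nra.
  have h : 1 + v / 2 <= expR (v / 2) by exact: expR_ge1Dx.
  have e : expR v = expR (v / 2) ^+ 2 by rewrite -expRM_natl; congr expR; field.
  have h2 : (1 + v / 2) ^+ 2 <= expR v by rewrite e ler_sqr// nnegrE; lra.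
  nra.
nra.
Qed.

Lemma ln2_ge : 69 / 100 <= ln 2 :> R.
Proof.
(* 1 / 2 = (1 - 1 / 9) * (1 - 1 / 4) ^+ 2 *)
have h9 := @ln1D_le_cubic (- (1 / 9)) ltac:(lra).
have h4 := @ln1D_le_cubic (- (1 / 4)) ltac:(lra).
have -> : ln 2 = - (ln (1 + - (1 / 9)) + (ln (1 + - (1 / 4)) + ln (1 + - (1 / 4)))) :> R.
  rewrite -!lnM ?posrE; try lra.
  by rewrite -lnV ?posrE; [congr ln; field|lra].
lra.
Qed.

End calculus.

(** * Finite probability spaces *)

Section finite_probability.
Context (R : realType).
Implicit Types (T Th : finType) (l b kappa sigma delta : R) (n : nat).

Definition is_dist T (p : T -> R) := (forall x, 0 <= p x) /\ \sum_x p x = 1.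

Definition mean T (p f : T -> R) := \sum_x p x * f x.

Definition iid T n (p : T -> R) (t : n.-tuple T) := \prod_(i < n) p (tnth t i).

(** The finite counterpart of [mean_gap]. *)
Definition gap T n (p : T -> R) (t : n.-tuple T) (f : T -> R) :=
  mean p f - n%:R^-1 * \sum_(i < n) f (tnth t i).

Lemma eq_mean T (p f g : T -> R) : f =1 g -> mean p f = mean p g.
Proof. by move=> fg; apply: eq_bigr => x _; rewrite fg. Qed.

Lemma meanD T (p f g : T -> R) :
  mean p (fun x => f x + g x) = mean p f + mean p g.
Proof. by rewrite -big_split; apply: eq_bigr => x _; rewrite mulrDr. Qed.

Lemma meanN T (p f : T -> R) : mean p (fun x => - f x) = - mean p f.
Proof. by rewrite -sumrN; apply: eq_bigr => x _; rewrite mulrN. Qed.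

Lemma meanB T (p f g : T -> R) :
  mean p (fun x => f x - g x) = mean p f - mean p g.
Proof. by rewrite meanD meanN. Qed.

Lemma meanZ T (p f : T -> R) l : mean p (fun x => l * f x) = l * mean p f.
Proof. by rewrite mulr_sumr; apply: eq_bigr => x _; rewrite mulrCA. Qed.

Lemma meanZr T (p f : T -> R) l : mean p (fun x => f x * l) = mean p f * l.
Proof. by rewrite mulr_suml; apply: eq_bigr => x _; rewrite mulrA. Qed.

Lemma mean_cst T (p : T -> R) l : is_dist p -> mean p (fun=> l) = l.
Proof. by move=> [_ p1]; rewrite /mean -mulr_suml p1 mul1r. Qed.

Lemma mean_sum T (p : T -> R) (I : finType) (f : I -> T -> R) :
  mean p (fun x => \sum_i f i x) = \sum_i mean p (f i).
Proof.
by rewrite exchange_big; apply: eq_bigr => x _; rewrite mulr_sumr.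
Qed.

Lemma exchange_mean T Th (p : T -> R) (q : Th -> R) (f : T -> Th -> R) :
  mean p (fun x => mean q (f x)) = mean q (fun y => mean p (f^~ y)).
Proof.
rewrite /mean; under eq_bigr do rewrite mulr_sumr.
rewrite exchange_big/=; apply: eq_bigr => y _; rewrite mulr_sumr.
by apply: eq_bigr => x _; rewrite mulrCA.
Qed.

Lemma ler_mean T (p f g : T -> R) : is_dist p -> (forall x, f x <= g x) ->
  mean p f <= mean p g.
Proof. by move=> [p0 _] fg; apply: ler_sum => x _; rewrite ler_wpM2l. Qed.

Lemma mean_le T (p f : T -> R) l : is_dist p -> (forall x, f x <= l) ->
  mean p f <= l.
Proof. by move=> hp fg; rewrite -(mean_cst l hp); apply: ler_mean. Qed.

Lemma mean_ge T (p f : T -> R) l : is_dist p -> (forall x, l <= f x) ->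
  l <= mean p f.
Proof. by move=> hp fg; rewrite -(mean_cst l hp); apply: ler_mean. Qed.

Lemma dist_inhabited T (p : T -> R) : is_dist p -> exists x : T, True.
Proof.
move=> [_ p1]; have [x _|T0] := pickP (fun _ : T => true); first by exists x.
by move: p1; rewrite big_pred0// => /eqP; rewrite eq_sym oner_eq0.
Qed.

Lemma sqr_mean_le T (p f : T -> R) : is_dist p ->
  mean p f ^+ 2 <= mean p (fun x => f x ^+ 2).
Proof.
move=> hp; set m := mean p f.
have : 0 <= mean p (fun x => (f x - m) ^+ 2).
  by apply: mean_ge => // x; exact: sqr_ge0.
suff -> : mean p (fun x => (f x - m) ^+ 2) = mean p (fun x => f x ^+ 2) - m ^+ 2.
  by rewrite subr_ge0.
under eq_mean do rewrite sqrrB.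
rewrite meanD meanB mean_cst//.
under [X in _ - X + _]eq_mean do rewrite -mulr_natr.
by rewrite !meanZr -/m; ring.
Qed.

Definition dist_prod T Th (p : T -> R) (q : Th -> R) (z : T * Th) :=
  p z.1 * q z.2.

Lemma mean_prod T Th (p : T -> R) (q : Th -> R) f :
  mean (dist_prod p q) f = mean p (fun x => mean q (fun y => f (x, y))).
Proof.
rewrite /mean; under [RHS]eq_bigr do rewrite mulr_sumr.
by rewrite pair_big; apply: eq_bigr => -[x y] _; rewrite mulrA.
Qed.

Lemma dist_prodP T Th (p : T -> R) (q : Th -> R) :
  is_dist p -> is_dist q -> is_dist (dist_prod p q).
Proof.
move=> hp hq; split=> [[x y]|].
  by rewrite mulr_ge0//; [exact: hp.1 | exact: hq.1].
have <- : mean (dist_prod p q) (fun=> 1) = \sum_z dist_prod p q z.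
  by apply: eq_bigr => z _; rewrite mulr1.
by rewrite mean_prod (mean_cst 1 hq) mean_cst.
Qed.

Lemma mean_iid0 T (p : T -> R) (F : 0.-tuple T -> R) :
  mean (@iid T 0 p) F = F [tuple].
Proof.
rewrite /mean (big_pred1 [tuple])/=; first by rewrite /iid big_ord0 mul1r.
by move=> t; apply/esym/eqP; exact: tuple0.
Qed.

Lemma mean_iid_cons T n (p : T -> R) (F : n.+1.-tuple T -> R) :
  mean (@iid T n.+1 p) F =
  mean p (fun x => mean (@iid T n p) (fun t => F [tuple of x :: t])).
Proof.
rewrite -(mean_prod p (@iid T n p) (fun z => F [tuple of z.1 :: z.2])) /mean.
pose h (z : T * n.-tuple T) := [tuple of z.1 :: z.2].
rewrite (reindex h) /=; last first.
  exists (fun t : n.+1.-tuple T => (thead t, [tuple of behead t])).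
    by move=> [x t] _; rewrite /h theadE/=; congr pair; exact/val_inj.
  by move=> t _; rewrite /h/= -tuple_eta.
apply: eq_bigr => -[x t] _; congr (_ * _).
rewrite /iid /dist_prod/= big_ord_recl tnth0; congr (_ * _).
by apply: eq_bigr => i _; rewrite tnthS.
Qed.

Lemma iid_dist T n (p : T -> R) : is_dist p -> is_dist (@iid T n p).
Proof.
move=> hp; split=> [t|]; first by apply: prodr_ge0 => i _; exact: hp.1.
have <- : mean (@iid T n p) (fun=> 1) = \sum_(t : n.-tuple T) iid p t.
  by rewrite /mean; apply: eq_bigr => t _; rewrite mulr1.
elim: n => [|n IHn]; first by rewrite mean_iid0.
rewrite mean_iid_cons -[RHS](mean_cst 1 hp).
by apply: eq_mean => x; exact: IHn.
Qed.

Lemma mean_iid_prod T n (p : T -> R) (g : T -> R) :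
  mean (@iid T n p) (fun t => \prod_(i < n) g (tnth t i)) = mean p g ^+ n.
Proof.
elim: n => [|n IHn]; first by rewrite mean_iid0 big_ord0.
rewrite mean_iid_cons exprS -meanZr; apply: eq_mean => x.
rewrite -IHn -meanZ; apply: eq_mean => t.
rewrite big_ord_recl tnth0; congr (_ * _).
by apply: eq_bigr => i _; rewrite tnthS.
Qed.

Lemma mean_iid_tnth T n (p : T -> R) (g : T -> R) (i : 'I_n) : is_dist p ->
  mean (@iid T n p) (fun t => g (tnth t i)) = mean p g.
Proof.
move=> hp; elim: n i => [|n IHn] i; first by case: i.
rewrite mean_iid_cons; case: (unliftP ord0 i) => [j|] ->.
  rewrite -[RHS](mean_cst (mean p g) hp); apply: eq_mean => x.
  by rewrite -(IHn j); apply: eq_mean => t; rewrite tnthS.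
apply: eq_mean => x; rewrite -[RHS](mean_cst (g x) (iid_dist n hp)).
by apply: eq_mean => t; rewrite tnth0.
Qed.

Lemma gapD T n (p : T -> R) (t : n.-tuple T) f g :
  gap p t (fun x => f x + g x) = gap p t f + gap p t g.
Proof. by rewrite /gap meanD big_split/=; ring. Qed.

Lemma gapN T n (p : T -> R) (t : n.-tuple T) f :
  gap p t (fun x => - f x) = - gap p t f.
Proof. by rewrite /gap meanN sumrN; ring. Qed.

Lemma gapB T n (p : T -> R) (t : n.-tuple T) f g :
  gap p t (fun x => f x - g x) = gap p t f - gap p t g.
Proof. by rewrite gapD gapN. Qed.

Lemma gapZ T n (p : T -> R) (t : n.-tuple T) l f :
  gap p t (fun x => l * f x) = l * gap p t f.
Proof. by rewrite /gap meanZ -mulr_sumr; ring. Qed.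

Lemma eq_gap T n (p : T -> R) (t : n.-tuple T) f g : f =1 g ->
  gap p t f = gap p t g.
Proof.
move=> fg; rewrite /gap (eq_mean _ fg); congr (_ - _ * _).
by apply: eq_bigr => i _; rewrite fg.
Qed.

Lemma gap_cst T n (p : T -> R) (t : n.-tuple T) l : is_dist p -> (0 < n)%N ->
  gap p t (fun=> l) = 0.
Proof.
move=> hp n0; rewrite /gap mean_cst// sumr_const card_ord -(mulr_natl l) mulrA.
by rewrite mulVf ?pnatr_eq0 ?gtn_eqF// mul1r subrr.
Qed.

Lemma gap_mean T Th n (p : T -> R) (t : n.-tuple T) (q : Th -> R) f :
  gap p t (fun x => mean q (f^~ x)) = mean q (fun y => gap p t (f y)).
Proof.
rewrite /gap meanB meanZ; congr (_ - _ * _).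
  exact: (exchange_mean p q (fun x y => f y x)).
exact/esym/mean_sum.
Qed.

Lemma empirical_mean_le T n (t : n.-tuple T) (f : T -> R) l : (0 < n)%N ->
  (forall x, f x <= l) -> n%:R^-1 * \sum_(i < n) f (tnth t i) <= l.
Proof.
move=> n0 fl; rewrite ler_pdivrMl ?ltr0n// mulr_natl -[n in leRHS]card_ord.
by rewrite -sumr_const; apply: ler_sum.
Qed.

Lemma gap_le T n (p : T -> R) (t : n.-tuple T) f l b : is_dist p -> (0 < n)%N ->
  (forall x, l <= f x <= b) -> gap p t f <= b - l.
Proof.
move=> hp n0 fl; apply: lerB; first by apply: mean_le => // x; case/andP: (fl x).
rewrite -lerN2 -mulrN -sumrN; apply: (@empirical_mean_le _ _ _ (fun x => - f x)) => // x.
by rewrite lerN2; case/andP: (fl x).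
Qed.

Lemma mean_gap0 T n (p : T -> R) f : is_dist p -> (0 < n)%N ->
  mean (@iid T n p) (fun t => gap p t f) = 0.
Proof.
move=> hp n0; rewrite meanB mean_cst; last exact: iid_dist.
rewrite meanZ (mean_sum _ (fun i t => f (tnth t i))).
under eq_bigr do rewrite mean_iid_tnth//.
rewrite sumr_const card_ord -(mulr_natl (mean p f)) mulrA.
by rewrite mulVf ?pnatr_eq0 ?gtn_eqF// mul1r subrr.
Qed.

(** * Concentration *)

(** Convexity of the exponential reduces the claim to a sign with the same
    mean. *)
Lemma hoeffding T (p f : T -> R) l b : is_dist p -> 0 < b ->
  (forall x y, f x - f y <= b) ->
  mean p (fun x => expR (l * (f x - mean p f))) <= expR (l ^+ 2 * b ^+ 2 / 8).
Proof.
move=> hp b0 fb; have [x0 _] := dist_inhabited hp.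
case: (@arg_minP _ R T x0 predT f isT) => a _ fa.
pose c := f a + b / 2; pose y x := (f x - c) / (b / 2).
have y11 x : -1 <= y x <= 1.
  rewrite /y ler_pdivlMr ?divr_gt0// ler_pdivrMr ?divr_gt0// /c.
  by have := fa x isT; have := fb x a; lra.
set m := mean p y.
have mE : mean p f = c + b / 2 * m.
  rewrite /m -meanZ -[c in RHS](mean_cst c hp) -meanD.
  by apply: eq_mean => x; rewrite /y; field; rewrite gt_eqF.
have m11 : -1 <= m <= 1.
  by rewrite /m mean_ge ?mean_le// => x; case/andP: (y11 x).
pose k := l * (b / 2).
have -> : mean p (fun x => expR (l * (f x - mean p f)))
    = mean p (fun x => expR (k * (y x - m))).
  apply: eq_mean => x; congr expR; rewrite mE /k /y; field.
  by rewrite gt_eqF.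
have chord x : expR (k * (y x - m)) <=
    (1 + y x) / 2 * expR (k * (1 - m)) + (1 - y x) / 2 * expR (k * (-1 - m)).
  have e1 : k * (1 - m) = k * (y x - m) + k * (1 - y x) by ring.
  have e2 : k * (-1 - m) = k * (y x - m) + k * (-1 - y x) by ring.
  rewrite e1 e2 2!expRD; set E := expR (k * (y x - m)).
  have E0 : 0 < E by exact: expR_gt0.
  have h1 := expR_ge1Dx (k * (1 - y x)).
  have h2 := expR_ge1Dx (k * (-1 - y x)).
  have /andP[y1 y2] := y11 x.
  have a1 : 0 <= (1 + y x) / 2 by lra.
  have a2 : 0 <= (1 - y x) / 2 by lra.
  rewrite !(mulrCA _ E) -mulrDr -[leLHS]mulr1 ler_wpM2l ?(ltW E0)//.
  apply: le_trans (lerD (ler_wpM2l a1 h1) (ler_wpM2l a2 h2)).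
  by rewrite le_eqVlt; apply/orP; left; apply/eqP; field.
apply: le_trans (ler_mean hp chord) _.
rewrite meanD !meanZr meanD meanB !mean_cst// -/m.
apply: le_trans (sign_mgf_le k m11) _.
by rewrite ler_expR le_eqVlt; apply/orP; left; apply/eqP; rewrite /k; field.
Qed.

Definition bounded_differences T n (F : n.-tuple T -> R) b :=
  forall (t t' : n.-tuple T) (i : 'I_n),
    (forall j, j != i -> tnth t j = tnth t' j) -> F t - F t' <= b.

(** The coordinates are integrated out one at a time, each by [hoeffding]. *)
Lemma mcdiarmid_mgf T n (p : T -> R) (F : n.-tuple T -> R) l b :
  is_dist p -> 0 < b -> bounded_differences F b ->
  mean (@iid T n p) (fun t => expR (l * (F t - mean (@iid T n p) F)))
    <= expR (n%:R * (l ^+ 2 * b ^+ 2 / 8)).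
Proof.
move=> hp b0; elim: n F => [|n IHn] F Fb.
  by rewrite !mean_iid0 subrr mulr0 mul0r.
pose G x := mean (@iid T n p) (fun t => F [tuple of x :: t]).
have EG : mean (@iid T n.+1 p) F = mean p G by exact: mean_iid_cons.
have Gb x y : G x - G y <= b.
  rewrite /G -meanB; apply: mean_le => [|t]; first exact: iid_dist.
  apply: (Fb _ _ ord0) => j; case: (unliftP ord0 j) => [i|] -> //.
  by rewrite !tnthS.
have Fxb x : bounded_differences (fun t : n.-tuple T => F [tuple of x :: t]) b.
  move=> t t' i tt'; apply: (Fb _ _ (lift ord0 i)) => j.
  case: (unliftP ord0 j) => [k|] -> ij; last by rewrite !tnth0.
  by rewrite !tnthS; apply: tt'; apply: contraNneq ij => ->.
rewrite EG mean_iid_cons.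
apply: (@le_trans _ _ (mean p (fun x => expR (l * (G x - mean p G)) *
    expR (n%:R * (l ^+ 2 * b ^+ 2 / 8))))).
  apply: ler_mean => // x.
  apply: le_trans (ler_wpM2l (expR_ge0 _) (IHn _ (Fxb x))).
  rewrite -meanZ le_eqVlt; apply/orP; left; apply/eqP/eq_mean => t.
  by rewrite -expRD -/(G x); congr expR; ring.
rewrite meanZr mulrC -[n.+1%:R]natr1 mulrDl mul1r expRD ler_wpM2l ?expR_ge0//.
exact: hoeffding.
Qed.

Lemma markov_le T (p f : T -> R) (c : R) : is_dist p -> (forall x, 0 <= f x) ->
  0 < c -> \sum_(x | c < f x) p x <= mean p f / c.
Proof.
move=> [p0 _] f0 c0; rewrite ler_pdivlMr// mulr_suml /mean.
rewrite [leRHS](bigID (fun x => c < f x))/= -[leLHS]addr0.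
apply: lerD; last by apply: sumr_ge0 => x _; rewrite mulr_ge0.
by apply: ler_sum => x cf; rewrite ler_wpM2l// ltW.
Qed.

Lemma sum_compl T (p : T -> R) (P : pred T) : is_dist p ->
  \sum_(x | P x) p x = 1 - \sum_(x | ~~ P x) p x.
Proof. by move=> [_ <-]; rewrite [in RHS](bigID P)/= addrK. Qed.

Lemma mcdiarmid T n (p : T -> R) (F : n.-tuple T -> R) b delta :
  is_dist p -> 0 < b -> bounded_differences F b -> (0 < n)%N -> 0 < delta < 1 ->
  1 - delta <= \sum_(t | F t <= mean (@iid T n p) F
                 + b * Num.sqrt (n%:R * ln delta^-1 / 2)) iid p t.
Proof.
move=> hp b0 Fb n0 /andP[d0 d1]; set m := mean _ _.
have nR : 0 < n%:R :> R by rewrite ltr0n.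
have L0 : 0 < ln delta^-1 by rewrite ln_gt0// invf_gt1.
set s := Num.sqrt _.
have s0 : 0 < s by rewrite sqrtr_gt0 divr_gt0// mulr_gt0.
have s2 : s ^+ 2 = n%:R * ln delta^-1 / 2.
  by rewrite sqr_sqrtr// divr_ge0// mulr_ge0 ?ltW.
have hi := @iid_dist _ n _ hp.
rewrite (sum_compl _ hi) lerB//.
(* the minimizer of [n * (l ^+ 2 * b ^+ 2 / 8) - l * (b * s)] *)
pose l := 4 * s / (n%:R * b).
have l0 : 0 < l by rewrite divr_gt0 ?mulr_gt0.
have E0 : 0 < expR (l * (b * s)) by exact: expR_gt0.
have -> : \sum_(t | ~~ (F t <= m + b * s)) iid p t =
    \sum_(t | expR (l * (b * s)) < expR (l * (F t - m))) iid p t.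
  apply: eq_bigl => t; rewrite -ltNge ltr_expR ltr_pM2l//.
  by rewrite ltrBrDl.
apply: le_trans (markov_le hi (fun=> expR_ge0 _) E0) _.
rewrite ler_pdivrMr//; apply: le_trans (mcdiarmid_mgf l hp b0 Fb) _.
rewrite -[delta]invrK -[X in X^-1 * _]lnK ?posrE ?invr_gt0// -expRN -expRD.
rewrite ler_expR le_eqVlt; apply/orP; left; apply/eqP.
have -> : ln delta^-1 = 2 * s ^+ 2 / n%:R by rewrite s2; field; rewrite gt_eqF.
by rewrite /l; field; rewrite !gt_eqF.
Qed.

(** * The PAC-Bayesian inequality *)

(** The quadratic terms, with weights [1 / 6] at the sample and [1 / 3] under the
    law, are those of [expR_self_normalized]; since they add up to [1 / 2], an
    unbounded [f] is controlled at the price of its second moment. *)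
Lemma mean_expR_gap_le1 T n (p f : T -> R) l : is_dist p ->
  mean (@iid T n p) (fun t => expR (\sum_(i < n) (l * (mean p f - f (tnth t i))
     - l ^+ 2 / 6 * f (tnth t i) ^+ 2 - l ^+ 2 / 3 * mean p (fun x => f x ^+ 2))))
  <= 1.
Proof.
move=> hp.
pose h x := l * (mean p f - f x) - l ^+ 2 / 6 * f x ^+ 2
            - l ^+ 2 / 3 * mean p (fun x => f x ^+ 2).
have -> : mean (@iid T n p) (fun t => expR (\sum_(i < n) h (tnth t i)))
    = mean p (fun x => expR (h x)) ^+ n.
  by rewrite -mean_iid_prod; apply: eq_mean => t; exact: expR_sum.
apply: exprn_ile1; first by apply: mean_ge => // x; exact: expR_ge0.
set v := mean p (fun x => f x ^+ 2) in h *.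
pose a := l * mean p f - l ^+ 2 / 3 * v.
apply: (@le_trans _ _ (mean p (fun x =>
    expR a * (1 + - l * f x + l ^+ 2 / 3 * f x ^+ 2)))).
  apply: ler_mean => // x.
  have -> : h x = a + (- l * f x - (- l * f x) ^+ 2 / 6) by rewrite /h /a; ring.
  rewrite expRD ler_wpM2l ?expR_ge0//.
  apply: le_trans (expR_self_normalized _) _.
  by rewrite le_eqVlt; apply/orP; left; apply/eqP; field.
rewrite meanZ !meanD mean_cst// !meanZ -/v.
have -> : 1 + - l * mean p f + l ^+ 2 / 3 * v = 1 + - a by rewrite /a; ring.
apply: le_trans (ler_wpM2l (expR_ge0 a) (expR_ge1Dx (- a))) _.
by rewrite expRxMexpNx_1.
Qed.

(** The Gibbs variational inequality, with the logarithm of the prior mean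
    replaced by its tangent at [1]: this makes it linear in the exponential
    moment, which can then be averaged over the sample. *)
Lemma gibbs_le Th (pi rho h : Th -> R) :
  (forall x, 0 < pi x) -> (forall x, 0 < rho x) -> is_dist rho ->
  mean rho h <= mean rho (fun x => ln (rho x / pi x)) +
                (mean pi (fun x => expR (h x)) - 1).
Proof.
move=> pi0 rho0 hrho; rewrite -lerBlDl -meanB.
have -> : mean pi (fun x => expR (h x)) - 1 =
    mean rho (fun x => expR (h x - ln (rho x / pi x)) - 1).
  rewrite meanB mean_cst//; congr (_ - _); apply: eq_bigr => x _.
  rewrite expRB lnK ?posrE ?divr_gt0//; field.
  by rewrite !gt_eqF.
apply: ler_mean => // x.
by have := expR_ge1Dx (h x - ln (rho x / pi x)); lra.
Qed.

(** The weights [rho t] depend on the sample, but the prior [pi] does not: for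
    each parameter the exponential moment is averaged over the sample first, and
    the dependence costs only the relative entropy.  The bound is the optimum
    over [l] of [kappa / (n * l) + l * sigma2 / 2]. *)
Lemma pac_bayes T Th n (p : T -> R) (pi : Th -> R)
    (rho : n.-tuple T -> Th -> R) (D : Th -> T -> R) (kappa sigma2 : R) :
  is_dist p -> is_dist pi -> (forall x, 0 < pi x) ->
  (forall t, is_dist (rho t)) -> (forall t x, 0 < rho t x) -> (0 < n)%N ->
  0 < kappa -> 0 < sigma2 ->
  (forall t, mean (rho t) (fun x => ln (rho t x / pi x)) <= kappa) ->
  (forall t x, mean (rho t) (fun y => D y x ^+ 2) <= sigma2) ->
  mean (@iid T n p) (fun t => mean (rho t) (fun y => gap p t (D y)))
    <= Num.sqrt (2 * kappa * sigma2 / n%:R).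
Proof.
move=> hp hpi pi0 hrho rho0 n0 k0 s0 kl var.
have nR : 0 < n%:R :> R by rewrite ltr0n.
have hi := @iid_dist _ n _ hp.
set M := mean _ _.
suff H l : 0 < l -> n%:R * l * M <= kappa + n%:R * (l ^+ 2 * sigma2 / 2).
  pose S := Num.sqrt (2 * kappa * sigma2 / n%:R).
  have S0 : 0 < S by rewrite sqrtr_gt0 divr_gt0// !mulr_gt0.
  have S2 : S ^+ 2 = 2 * kappa * sigma2 / n%:R.
    by rewrite sqr_sqrtr// divr_ge0 ?mulr_ge0// ltW.
  have l0 : 0 < S / sigma2 by rewrite divr_gt0.
  have := H _ l0; rewrite -/S.
  have -> : kappa + n%:R * ((S / sigma2) ^+ 2 * sigma2 / 2)
          = n%:R * (S / sigma2) * S.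
    have -> : kappa = S ^+ 2 * n%:R / (2 * sigma2).
      by rewrite S2; field; rewrite !gt_eqF.
    by field; rewrite gt_eqF.
  by rewrite ler_pM2l// mulr_gt0.
move=> l0.
pose h t y := \sum_(i < n) (l * (mean p (D y) - D y (tnth t i))
     - l ^+ 2 / 6 * D y (tnth t i) ^+ 2 - l ^+ 2 / 3 * mean p (fun x => D y x ^+ 2)).
have hE t y : h t y = n%:R * l * gap p t (D y)
    - l ^+ 2 / 6 * \sum_(i < n) D y (tnth t i) ^+ 2
    - l ^+ 2 / 3 * n%:R * mean p (fun x => D y x ^+ 2).
  rewrite /h !sumrB -mulr_sumr sumrB -!mulr_sumr !sumr_const card_ord.
  rewrite -(mulr_natl (mean p (D y))) -(mulr_natl (mean p (fun x => D y x ^+ 2))).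
  by rewrite /gap; field; rewrite gt_eqF.
have main : mean (@iid T n p) (fun t => mean (rho t) (h t)) <= kappa.
  apply: (@le_trans _ _ (mean (@iid T n p) (fun t => kappa +
      (mean pi (fun y => expR (h t y)) - 1)))).
    apply: ler_mean => // t; apply: le_trans (gibbs_le _ pi0 (rho0 t) (hrho t)) _.
    by rewrite lerD2r.
  rewrite meanD meanB !mean_cst// gerDl subr_le0 exchange_mean.
  by apply: mean_le => // y; exact: mean_expR_gap_le1.
have lower t : n%:R * l * mean (rho t) (fun y => gap p t (D y))
    - n%:R * (l ^+ 2 * sigma2 / 2) <= mean (rho t) (h t).
  have lin a b c (f g k : Th -> R) :
      mean (rho t) (fun y => a * f y - b * g y - c * k y) =
      a * mean (rho t) f - b * mean (rho t) g - c * mean (rho t) k.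
    by rewrite 2!meanB !meanZ.
  rewrite (eq_mean _ (hE t)) lin.
  have -> : mean (rho t) (fun y => \sum_(i < n) D y (tnth t i) ^+ 2) =
      \sum_(i < n) mean (rho t) (fun y => D y (tnth t i) ^+ 2) by exact: mean_sum.
  rewrite (exchange_mean (rho t)).
  have h1 : \sum_(i < n) mean (rho t) (fun y => D y (tnth t i) ^+ 2) <= n%:R * sigma2.
    apply: (@le_trans _ _ (\sum_(i < n) sigma2)); first exact: ler_sum.
    by rewrite sumr_const card_ord mulr_natl.
  have h2 : mean p (fun x => mean (rho t) (fun y => D y x ^+ 2)) <= sigma2.
    by apply: mean_le => // x; exact: var.
  have l2 : 0 <= l ^+ 2 by exact: sqr_ge0.
  have a1 : 0 <= l ^+ 2 / 6 by rewrite divr_ge0.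
  have a2 : 0 <= l ^+ 2 / 3 * n%:R by rewrite mulr_ge0 ?divr_ge0// ltW.
  have := lerD (ler_wpM2l a1 h1) (ler_wpM2l a2 h2); lra.
have := le_trans (ler_mean hi lower) main.
rewrite meanB meanZ mean_cst// -/M; lra.
Qed.

End finite_probability.

(** * Random signs *)

Section signs.
Context (R : realType).
Implicit Types (J : finType) (l s : R).

Definition sgn (b : bool) : R := if b then 1 else -1.

(** The law of independent signs of means [m j]. *)
Definition sign_dist J (m : J -> R) (th : {ffun J -> bool}) :=
  \prod_j ((1 + sgn (th j) * m j) / 2).

Lemma mean_sign_prod J (m : J -> R) (h : J -> bool -> R) :
  mean (sign_dist m) (fun th => \prod_j h j (th j)) =
  \prod_j ((1 + m j) / 2 * h j true + (1 - m j) / 2 * h j false).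
Proof.
have -> : \prod_j ((1 + m j) / 2 * h j true + (1 - m j) / 2 * h j false) =
    \prod_j \sum_(b : bool) ((1 + sgn b * m j) / 2 * h j b).
  by apply: eq_bigr => j _; rewrite big_bool/= mul1r mulN1r.
rewrite bigA_distr_bigA; apply: eq_bigr => th _.
by rewrite /sign_dist -big_split.
Qed.

Lemma sign_distP J (m : J -> R) : (forall j, -1 < m j < 1) ->
  is_dist (sign_dist m) /\ (forall th, 0 < sign_dist m th).
Proof.
move=> m1.
have pos th : 0 < sign_dist m th.
  apply: prodr_gt0 => j _; rewrite divr_gt0//.
  by have /andP[? ?] := m1 j; case: (th j) => /=; lra.
split=> //; split=> [th|]; first exact: ltW.
have := mean_sign_prod m (fun _ _ => 1).
rewrite [RHS]big1; last by move=> j _; field.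
by move=> <-; apply: eq_bigr => th _; rewrite big1// mulr1.
Qed.

Lemma mean_sign_coord J (m : J -> R) (i : J) (h : bool -> R) :
  mean (sign_dist m) (fun th => h (th i)) =
  (1 + m i) / 2 * h true + (1 - m i) / 2 * h false.
Proof.
have := mean_sign_prod m (fun j b => if j == i then h b else 1).
rewrite [RHS](bigD1 i)//= eqxx [X in _ * X]big1 => [|j /negPf ->]; last by field.
rewrite mulr1 => <-; apply: eq_mean => th.
by rewrite (bigD1 i)//= eqxx big1 ?mulr1// => j /negPf ->.
Qed.

Lemma sign_dist_mgf_le J (m a : J -> R) : (forall j, -1 < m j < 1) ->
  mean (sign_dist m) (fun th => expR (\sum_j a j * (sgn (th j) - m j))) <=
  expR (\sum_j a j ^+ 2 / 2).
Proof.
move=> m1; rewrite expR_sum.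
have -> : mean (sign_dist m) (fun th => expR (\sum_j a j * (sgn (th j) - m j))) =
    mean (sign_dist m) (fun th => \prod_j expR (a j * (sgn (th j) - m j))).
  by apply: eq_mean => th; rewrite expR_sum.
rewrite (mean_sign_prod m (fun j b => expR (a j * (sgn b - m j)))).
apply: ler_prod => j _; have /andP[m_gt m_lt] := m1 j; apply/andP; split.
  by rewrite addr_ge0// mulr_ge0 ?expR_ge0// divr_ge0//; lra.
by rewrite /sgn; apply: sign_mgf_le; rewrite !ltW.
Qed.

Definition fair_signs J : {ffun J -> bool} -> R := sign_dist (fun=> 0).

Lemma sign_dist_entropy_le J (m : J -> R) : (forall j, -1 < m j < 1) ->
  mean (sign_dist m) (fun th => ln (sign_dist m th / fair_signs th)) <=
  \sum_j (m j ^+ 2 / 2 + m j ^+ 4 / 3).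
Proof.
move=> m1.
have pos b j : 0 < 1 + sgn b * m j.
  by have /andP[? ?] := m1 j; case: b => /=; lra.
have -> : mean (sign_dist m) (fun th => ln (sign_dist m th / fair_signs th)) =
    mean (sign_dist m) (fun th => \sum_j ln (1 + sgn (th j) * m j)).
  apply: eq_mean => th; apply: expR_inj.
  rewrite expR_sum lnK; last first.
    by rewrite posrE divr_gt0//; apply: (sign_distP _).2 => // j; rewrite ltrN10 ltr01.
  rewrite /sign_dist /fair_signs /sign_dist -prodf_div; apply: eq_bigr => j _.
  by rewrite lnK ?posrE// mulr0 addr0; field.
rewrite mean_sum; apply: ler_sum => j _.
rewrite (mean_sign_coord m j (fun b => ln (1 + sgn b * m j))) /= mul1r mulN1r.
exact: sign_entropy_le.
Qed.

(** The square of [D] is compared to its tangent in the variable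
    [expR (l * `|D|)], which is at most the sum of the [2 * k] exponentials
    [expR (l * Y j)] and [expR (- l * Y j)].  For [l ^+ 2 * tau2 = 2 * ln (2 * k)]
    the mean of this sum is at most the exponential of the tangent point
    [2 * ln (2 * k)], and the linear correction is nonpositive. *)
Lemma mean_sqr_max_le (Th : finType) (q : Th -> R) k (Y : 'I_k -> Th -> R)
    (D : Th -> R) (tau2 : R) :
  is_dist q -> (2 <= k)%N -> 0 < tau2 ->
  (forall j l, mean q (fun y => expR (l * Y j y)) <= expR (l ^+ 2 * tau2 / 2)) ->
  (forall y, exists j, `|D y| <= `|Y j y|) ->
  mean q (fun y => D y ^+ 2) <= 2 * tau2 * ln (2 * k%:R).
Proof.
move=> hq k2 t0 mgf DY.
have k2R : 2 <= k%:R :> R by rewrite ler_nat.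
set L := ln (2 * k%:R).
have L1 : 1 <= L.
  rewrite -[leLHS]expRK ler_ln ?posrE ?expR_gt0//; last lra.
  have h : 1 / 2 <= expR (- (1 / 2) : R) by have := expR_ge1Dx (- (1 / 2) : R); lra.
  have := ler_pM _ _ h h; rewrite -expRD => /(_ ltac:(lra) ltac:(lra)).
  have -> : - (1 / 2) - 1 / 2 = - 1 :> R by field.
  by rewrite expRN -(div1r (expR 1)) ler_pdivlMr ?expR_gt0//; lra.
pose l := Num.sqrt (2 * L / tau2).
have l0 : 0 < l by rewrite sqrtr_gt0 divr_gt0// mulr_gt0//; lra.
have l2 : l ^+ 2 = 2 * L / tau2.
  by rewrite sqr_sqrtr// divr_ge0// ?mulr_ge0//; lra.
have expl : expR L = 2 * k%:R by rewrite lnK// posrE; lra.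
have tangent y : l ^+ 2 * D y ^+ 2 <= (2 * L) ^+ 2 +
    2 * (2 * L) * ((\sum_j (expR (l * Y j y) + expR (- l * Y j y)))
      * expR (- (2 * L)) - 1).
  have u0 : 0 <= l * `|D y| by rewrite mulr_ge0// ltW.
  have L2 : 2 <= 2 * L by lra.
  rewrite -[D y ^+ 2]real_normK ?num_real// -exprMn.
  apply: le_trans (sqr_le_tangent L2 u0) _.
  rewrite lerD2l ler_wpM2l ?lerD2r ?expRD//; first lra.
  rewrite ler_wpM2r ?expR_ge0//.
  have [j Dj] := DY y.
  rewrite (bigD1 j)//=.
  apply: ler_wpDr; first by apply: sumr_ge0 => i _; rewrite addr_ge0 ?expR_ge0.
  apply: (@le_trans _ _ (expR (l * `|Y j y|))).
    by rewrite ler_expR ler_pM2l.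
  have [Y0|Y0] := ger0P (Y j y); first by rewrite lerDl expR_ge0.
  by rewrite mulrN mulNr lerDr expR_ge0.
have := ler_mean hq tangent; rewrite meanZ.
have -> : mean q (fun y => (2 * L) ^+ 2 +
    2 * (2 * L) * ((\sum_j (expR (l * Y j y) + expR (- l * Y j y)))
      * expR (- (2 * L)) - 1)) =
  (2 * L) ^+ 2 + 2 * (2 * L) * ((\sum_j (mean q (fun y => expR (l * Y j y)) +
      mean q (fun y => expR (- l * Y j y)))) * expR (- (2 * L)) - 1).
  rewrite meanD mean_cst// meanZ meanB mean_cst// meanZr.
  by rewrite mean_sum; under [in LHS]eq_bigr do rewrite meanD.
move=> /le_trans H.
have {}H : l ^+ 2 * mean q (fun y => D y ^+ 2) <= (2 * L) ^+ 2.
  apply: H; rewrite gerDl mulr_ge0_le0//; first lra.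
  rewrite subr_le0 expRN ler_pdivrMr ?expR_gt0// mul1r.
  have -> : expR (2 * L) = \sum_(j < k) (expR L + expR L).
    rewrite sumr_const card_ord -(mulr_natl (_ + _)).
    have -> : 2 * L = L + L by ring.
    by rewrite expRD expl; ring.
  have lt : l ^+ 2 * tau2 / 2 = L by rewrite l2; field; rewrite gt_eqF.
  apply: ler_sum => j _; apply: lerD; apply: le_trans (mgf _ _) _.
    by rewrite lt.
  by rewrite sqrrN lt.
have -> : 2 * tau2 * L = (2 * L) ^+ 2 / l ^+ 2.
  by rewrite l2; field; rewrite !gt_eqF//; lra.
by rewrite ler_pdivlMr ?exprn_gt0// mulrC.
Qed.

End signs.

(** * The chaining argument *)

Section min_family_lemmas.
Context (R : realType) (k : nat) (k0 : (0 < k)%N).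
Implicit Types F G : 'I_k -> R.

Lemma min_family_attained F : exists j, min_family F = F j.
Proof.
case: k k0 F => // k' _ F /=.
elim/big_ind: _ => [|x y [i ->] [j ->]|j _]; [by exists ord0| |by exists j].
by rewrite /Order.min; case: ifP => _; [exists i|exists j].
Qed.

Lemma min_family_le F j : min_family F <= F j.
Proof. by case: k k0 F j => // k' _ F j /=; exact: bigmin_le_cond. Qed.

Lemma min_family_ge F b : (forall j, b <= F j) -> b <= min_family F.
Proof. by move=> bF; have [j ->] := min_family_attained F. Qed.

Lemma le_min_family F G : (forall j, F j <= G j) -> min_family F <= min_family G.
Proof.
move=> FG; apply: min_family_ge => j.
exact: le_trans (min_family_le _ _) (FG j).
Qed.

Lemma dist_min_family F G : exists j, `|min_family F - min_family G| <= `|F j - G j|.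
Proof.
have [i Fi] := min_family_attained F; have [j Gj] := min_family_attained G.
have h1 := min_family_le F j; have h2 := min_family_le G i.
have [h|h] := leP (min_family F) (min_family G).
  exists i; rewrite ler0_norm ?subr_le0// distrC ger0_norm; lra.
by exists j; rewrite gtr0_norm ?subr_gt0// ger0_norm; lra.
Qed.

Lemma min_family_affine F (a b : R) : 0 <= b ->
  min_family (fun j => a + b * F j) = a + b * min_family F.
Proof.
move=> b0; apply/le_anti/andP; split.
  have [j ->] := min_family_attained F; exact: min_family_le.
by apply: min_family_ge => j; rewrite lerD2l ler_wpM2l// min_family_le.
Qed.

End min_family_lemmas.

Section chaining.
Context (R : realType) (k : nat) (k2 : (2 <= k)%N) (A : finType).
Implicit Types (v : 'I_k -> A -> R) (z : A -> R) (s : R).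

(** The quantization loss after the reduction that makes it linear in the
    centres: [mean_gap_linear_le] below. *)
Definition score v z : R := min_family (fun j => -2 * \sum_a v j a * z a).

Local Notation signs := {ffun 'I_k * A -> bool}.

Definition decode s (th : signs) (j : 'I_k) (a : A) : R := s * sgn R (th (j, a)).

(** The posterior at scale [s]: signs biased so that [decode s] has mean [v].
    The corresponding prior, [fair_signs], does not depend on [v]. *)
Definition level s v : signs -> R := sign_dist (fun ja => v ja.1 ja.2 / s).

Definition noise s v z (j : 'I_k) (th : signs) : R :=
  \sum_a (decode s th j a - v j a) * z a.

Let k0 : (0 < k)%N. Proof. exact: ltn_trans k2. Qed.

Let sum_pair (F : 'I_k * A -> R) : \sum_p F p = \sum_j \sum_a F (j, a).
Proof. by rewrite pair_bigA; apply: eq_bigr => -[]. Qed.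

(** The coordinates must be within the reach [s] of a scaled sign; the margin
    [1 / 10] makes the quartic term of [sign_entropy_le] a fraction [1 / 150] of
    the quadratic one. *)
Definition scaled s v := 0 < s /\ forall j a, `|v j a| <= s / 10.

Let scaled1 s v : scaled s v -> forall ja, -1 < v ja.1 ja.2 / s < 1.
Proof.
move=> [s0 vs] [j a]/=; rewrite ltr_pdivlMr// ltr_pdivrMr//.
by have := vs j a; rewrite ler_norml => /andP[? ?]; lra.
Qed.

Lemma level_dist s v : scaled s v -> is_dist (level s v).
Proof. by move=> sv; exact: (sign_distP (scaled1 sv)).1. Qed.

Lemma level_gt0 s v th : scaled s v -> 0 < level s v th.
Proof. by move=> sv; exact: (sign_distP (scaled1 sv)).2. Qed.

Lemma noise_mgf_le s v z j l : scaled s v -> \sum_a z a ^+ 2 <= 5 / 4 ->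
  mean (level s v) (fun th => expR (l * noise s v z j th)) <=
  expR (l ^+ 2 * (5 / 4 * s ^+ 2) / 2).
Proof.
move=> sv z2; have s0 := sv.1.
pose b (ja : 'I_k * A) := if ja.1 == j then l * s * z ja.2 else 0.
have -> : mean (level s v) (fun th => expR (l * noise s v z j th)) =
    mean (level s v) (fun th =>
      expR (\sum_ja b ja * (sgn R (th ja) - v ja.1 ja.2 / s))).
  apply: eq_mean => th; congr expR.
  rewrite sum_pair (bigD1 j)//= [X in _ = _ + X]big1 => [|i /negPf ij]; last first.
    by rewrite big1// => a _; rewrite /b/= ij mul0r.
  rewrite addr0 /noise mulr_sumr; apply: eq_bigr => a _.
  by rewrite /b/= eqxx /decode; field; rewrite gt_eqF.
apply: le_trans (sign_dist_mgf_le _ (scaled1 sv)) _.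
rewrite ler_expR -mulr_suml ler_pM2r ?invr_gt0//.
rewrite sum_pair (bigD1 j)//= [X in _ + X]big1 => [|i /negPf ij]; last first.
  by rewrite big1// => a _; rewrite /b/= ij expr0n.
rewrite addr0; under eq_bigr do rewrite /b/= eqxx exprMn.
rewrite -mulr_sumr.
have -> : l ^+ 2 * (5 / 4 * s ^+ 2) = (l * s) ^+ 2 * (5 / 4) by ring.
by rewrite ler_wpM2l ?sqr_ge0.
Qed.

Lemma level_entropy_le s v : scaled s v ->
  (forall j, \sum_a v j a ^+ 2 <= 5 / 4) ->
  mean (level s v) (fun th => ln (level s v th / fair_signs R th)) <=
  (151 / 150) * (k%:R * (5 / 4) / (2 * s ^+ 2)).
Proof.
move=> sv v2; have s0 := sv.1.
apply: le_trans (sign_dist_entropy_le (scaled1 sv)) _.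
apply: (@le_trans _ _ (\sum_(ja : 'I_k * A) 151 / 300 * s ^- 2 * v ja.1 ja.2 ^+ 2)).
  apply: ler_sum => -[j a] _ /=.
  have h : (v j a / s) ^+ 2 <= 1 / 100.
    have -> : 1 / 100 = (1 / 10) ^+ 2 :> R by field.
    rewrite -[leLHS]real_normK ?num_real// ler_sqr ?nnegrE ?divr_ge0//.
    rewrite normrM normfV (gtr0_norm s0) ler_pdivrMr//.
    by have := sv.2 j a; lra.
  rewrite -[leRHS]mulrA.
  have -> : s ^- 2 * v j a ^+ 2 = (v j a / s) ^+ 2 by field; rewrite gt_eqF.
  have -> : (v j a / s) ^+ 4 = (v j a / s) ^+ 2 * (v j a / s) ^+ 2 by ring.
  by have := sqr_ge0 (v j a / s); nra.
rewrite -mulr_sumr sum_pair/=.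
apply: (@le_trans _ _ (151 / 300 * s ^- 2 * (\sum_(j < k) (5 / 4)))).
  by rewrite ler_wpM2l ?ler_sum// mulr_ge0 ?invr_ge0 ?exprn_ge0 ?(ltW s0)//; lra.
rewrite sumr_const card_ord -(mulr_natl (5 / 4)).
by rewrite le_eqVlt; apply/orP; left; apply/eqP; field; rewrite gt_eqF.
Qed.

Lemma dist_score v w z :
  exists j, `|score v z - score w z| <= `|2 * \sum_a (v j a - w j a) * z a|.
Proof.
have [j h] := dist_min_family k0 (fun j => -2 * \sum_a v j a * z a)
                                 (fun j => -2 * \sum_a w j a * z a).
exists j; apply: le_trans h _; rewrite -mulrBr mulNr normrN -sumrB.
by rewrite le_eqVlt; apply/orP; left; apply/eqP; congr (`|_ * _|);
  apply: eq_bigr => a _; rewrite mulrBl.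
Qed.

Let ln2k_gt0 : 0 < ln (2 * k%:R) :> R.
Proof. by rewrite ln_gt0// -natrM ltr1n; case: k k2 => [|[]]. Qed.

Let lnk_ge : 69 / 100 <= ln k%:R :> R.
Proof.
by apply: (le_trans (ln2_ge R)); rewrite ler_ln ?posrE ?ltr0n ?ler_nat// ltnW.
Qed.

Let ln2k_le : ln (2 * k%:R) <= 2 * ln k%:R :> R.
Proof.
have k2R : 2 <= k%:R :> R by rewrite ler_nat.
rewrite lnM ?posrE//; last lra.
have : ln 2 <= ln k%:R :> R by rewrite ler_ln ?posrE//; lra.
by move=> ?; lra.
Qed.

Lemma level_score_var s v z : scaled s v -> \sum_a z a ^+ 2 <= 5 / 4 ->
  mean (level s v) (fun th => (score (decode s th) z - score v z) ^+ 2) <=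
  10 * s ^+ 2 * ln (2 * k%:R).
Proof.
move=> sv z2; have s0 := sv.1.
have -> : 10 * s ^+ 2 = 2 * (5 * s ^+ 2) by ring.
apply: (@mean_sqr_max_le _ _ _ k (fun j th => 2 * noise s v z j th)) => //.
- exact: level_dist.
- by rewrite mulr_gt0// exprn_gt0.
- move=> j l; under eq_mean do rewrite mulrA.
  apply: le_trans (noise_mgf_le j (l * 2) sv z2) _.
  by rewrite ler_expR le_eqVlt; apply/orP; left; apply/eqP; field.
- by move=> th; exact: dist_score.
Qed.

Lemma pair_score_var s s' v z : scaled s v -> scaled s' v ->
  \sum_a z a ^+ 2 <= 5 / 4 ->
  mean (dist_prod (level s v) (level s' v))
    (fun y => (score (decode s y.1) z - score (decode s' y.2) z) ^+ 2) <=
  10 * (s ^+ 2 + s' ^+ 2) * ln (2 * k%:R).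
Proof.
move=> sv sv' z2; have s0 := sv.1; have s0' := sv'.1.
have -> : 10 * (s ^+ 2 + s' ^+ 2) = 2 * (5 * (s ^+ 2 + s' ^+ 2)) by ring.
apply: (@mean_sqr_max_le _ _ _ k
  (fun j y => 2 * (noise s v z j y.1 - noise s' v z j y.2))) => //.
- by apply: dist_prodP; exact: level_dist.
- by rewrite mulr_gt0// addr_gt0// exprn_gt0.
- move=> j l; rewrite mean_prod/=.
  have -> : mean (level s v) (fun x => mean (level s' v) (fun y =>
      expR (l * (2 * (noise s v z j x - noise s' v z j y))))) =
    mean (level s v) (fun x => expR ((l * 2) * noise s v z j x)) *
    mean (level s' v) (fun y => expR ((- l * 2) * noise s' v z j y)).
    rewrite -meanZr; apply: eq_mean => x; rewrite -meanZ; apply: eq_mean => y.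
    by rewrite -expRD; congr expR; ring.
  apply: (@le_trans _ _ (expR ((l * 2) ^+ 2 * (5 / 4 * s ^+ 2) / 2) *
                         expR ((- l * 2) ^+ 2 * (5 / 4 * s' ^+ 2) / 2))).
    apply: ler_pM; last 2 first; try exact: noise_mgf_le.
      by apply: mean_ge => [|x]; [exact: level_dist|exact: expR_ge0].
    by apply: mean_ge => [|x]; [exact: level_dist|exact: expR_ge0].
  by rewrite -expRD ler_expR le_eqVlt; apply/orP; left; apply/eqP; field.
- move=> [th th']/=; have [j h] := dist_score (decode s th) (decode s' th') z.
  exists j; apply: le_trans h _; rewrite le_eqVlt; apply/orP; left; apply/eqP.
  by congr (`|_ * _|); rewrite /noise -sumrB; apply: eq_bigr => a _; ring.
Qed.

Context (T : finType) (n : nat) (n0 : (0 < n)%N) (p : T -> R) (hp : is_dist p)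
  (z : T -> A -> R) (z2 : forall x, \sum_a z x a ^+ 2 <= 5 / 4).
Implicit Types (t : n.-tuple T) (c : n.-tuple T -> 'I_k -> A -> R).

Let u : R := Num.sqrt (k%:R * ln k%:R / n%:R).

Let kR : 0 < k%:R :> R. Proof. by rewrite ltr0n. Qed.
Let nR : 0 < n%:R :> R. Proof. by rewrite ltr0n. Qed.

Let u2 : u ^+ 2 = k%:R * ln k%:R / n%:R.
Proof.
rewrite sqr_sqrtr// divr_ge0// mulr_ge0//.
by apply: le_trans lnk_ge; rewrite divr_ge0.
Qed.

Let sqrt_le_u (x a : R) : 0 <= a -> x <= a ^+ 2 * u ^+ 2 -> Num.sqrt x <= a * u.
Proof.
move=> a0 xa; rewrite -[leRHS]ger0_norm ?mulr_ge0 ?sqrtr_ge0//.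
by rewrite -sqrtr_sqr exprMn ler_wsqrtr.
Qed.

Definition level_gap s v t :=
  mean (level s v) (fun th => gap p t (fun x => score (decode s th) (z x))).

Definition bounded_coords c := forall t j, \sum_a c t j a ^+ 2 <= 5 / 4.

Let fairP : is_dist (@fair_signs R ('I_k * A)%type) /\
  forall th, 0 < @fair_signs R ('I_k * A)%type th.
Proof. by apply: sign_distP => j; rewrite ltrN10 ltr01. Qed.

(** Two consecutive levels are drawn independently.  Their entropies are of order
    [k / s ^+ 2] and the variance of the difference of their scores is of order
    [s ^+ 2 * ln k], so that the scale [s] cancels. *)
Lemma chain_link_le s c : bounded_coords c -> (forall t, scaled s (c t)) ->
  mean (@iid R T n p) (fun t => level_gap s (c t) t - level_gap (3 * s) (c t) t)
    <= 17 * u.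
Proof.
move=> c2 sc.
have sc' t : scaled (3 * s) (c t).
  have [s0 h] := sc t; split; first by rewrite mulr_gt0.
  by move=> j a; have := h j a; lra.
have [t0|t0] := pickP (fun t : n.-tuple T => true); last first.
  by rewrite /mean big_pred0// mulr_ge0// sqrtr_ge0.
move=> _; have s0 := (sc t0).1.
pose rho t := dist_prod (level s (c t)) (level (3 * s) (c t)).
pose pi := dist_prod (@fair_signs R ('I_k * A)%type) (@fair_signs R ('I_k * A)%type).
pose D (y : signs * signs) x := score (decode s y.1) (z x) - score (decode (3 * s) y.2) (z x).
have -> : mean (@iid R T n p) (fun t => level_gap s (c t) t - level_gap (3 * s) (c t) t) =
    mean (@iid R T n p) (fun t => mean (rho t) (fun y => gap p t (D y))).
  apply: eq_mean => t; rewrite /level_gap mean_prod.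
  have E x y : gap p t (D (x, y)) = gap p t (fun i => score (decode s x) (z i)) -
      gap p t (fun i => score (decode (3 * s) y) (z i)) by rewrite -gapB.
  under [RHS]eq_mean do (under eq_mean do rewrite E).
  under [RHS]eq_mean do (rewrite meanB (mean_cst _ (level_dist (sc' t)))).
  by rewrite [RHS]meanB [in RHS](mean_cst _ (level_dist (sc t))).
pose kappa : R := 151 / 150 * (10 / 9) * (k%:R * (5 / 4) / (2 * s ^+ 2)).
pose sigma2 : R := 100 * s ^+ 2 * ln (2 * k%:R).
have s2 : 0 < s ^+ 2 by rewrite exprn_gt0.
have kappa0 : 0 < kappa by rewrite /kappa !mulr_gt0// ?invr_gt0 ?mulr_gt0.
have sigma0 : 0 < sigma2 by rewrite /sigma2 !mulr_gt0.
apply: (@le_trans _ _ (Num.sqrt (2 * kappa * sigma2 / n%:R))).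
  apply: (@pac_bayes R T _ n p pi rho D kappa sigma2) => //.
  - by apply: dist_prodP; exact: fairP.1.
  - by move=> y; rewrite mulr_gt0//; exact: fairP.2.
  - by move=> t; apply: dist_prodP; exact: level_dist.
  - by move=> t y; rewrite mulr_gt0//; exact: level_gt0.
  - move=> t; rewrite mean_prod.
    have -> : mean (level s (c t)) (fun x => mean (level (3 * s) (c t)) (fun y =>
        ln (rho t (x, y) / pi (x, y)))) =
      mean (level s (c t)) (fun x => ln (level s (c t) x / fair_signs R x)) +
      mean (level (3 * s) (c t)) (fun x => ln (level (3 * s) (c t) x / fair_signs R x)).
      rewrite -[X in _ = _ + X](mean_cst _ (level_dist (sc t))) -meanD.
      apply: eq_mean => x.
      rewrite -[X in _ = X + _](mean_cst _ (level_dist (sc' t))) -meanD.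
      apply: eq_mean => y; rewrite /rho /pi /dist_prod/=.
      by rewrite -lnM ?posrE ?divr_gt0 ?level_gt0//; try exact: fairP.2; rewrite mulf_div.
    apply: le_trans (lerD (level_entropy_le (sc t) (c2 t)) (level_entropy_le (sc' t) (c2 t))) _.
    by rewrite /kappa le_eqVlt; apply/orP; left; apply/eqP; field; rewrite gt_eqF.
  - move=> t x; apply: le_trans (pair_score_var (sc t) (sc' t) (z2 x)) _.
    by rewrite /sigma2 le_eqVlt; apply/orP; left; apply/eqP; field.
apply: sqrt_le_u => //; rewrite u2.
have -> : 2 * kappa * sigma2 / n%:R =
    (151 / 150 * (10 / 9) * 125) * (k%:R * ln (2 * k%:R) / n%:R).
  by rewrite /kappa /sigma2; field; rewrite !gt_eqF.
have : k%:R * ln (2 * k%:R) / n%:R <= k%:R * (2 * ln k%:R) / n%:R :> R.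
  by rewrite ler_pM2r ?invr_gt0// ler_pM2l.
have -> : k%:R * (2 * ln k%:R) / n%:R = 2 * (k%:R * ln k%:R / n%:R) :> R by ring.
have : 0 <= k%:R * ln k%:R / n%:R :> R by rewrite -u2 sqr_ge0.
lra.
Qed.

Lemma score_abs_le v x : (forall j, \sum_a v j a ^+ 2 <= 5 / 4) ->
  `|score v (z x)| <= 5 / 2.
Proof.
move=> v2; have [j] := min_family_attained k0 (fun j => -2 * \sum_a v j a * z x a).
rewrite -/(score v (z x)) => ->.
have h1 : \sum_a (v j a - z x a) ^+ 2 >= 0 by apply: sumr_ge0 => a _; exact: sqr_ge0.
have h2 : \sum_a (v j a + z x a) ^+ 2 >= 0 by apply: sumr_ge0 => a _; exact: sqr_ge0.
have e1 : \sum_a (v j a - z x a) ^+ 2 =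
    \sum_a v j a ^+ 2 + \sum_a z x a ^+ 2 - 2 * \sum_a v j a * z x a.
  by rewrite mulr_sumr -big_split -sumrB; apply: eq_bigr => a _ /=; ring.
have e2 : \sum_a (v j a + z x a) ^+ 2 =
    \sum_a v j a ^+ 2 + \sum_a z x a ^+ 2 + 2 * \sum_a v j a * z x a.
  by rewrite mulr_sumr -!big_split; apply: eq_bigr => a _ /=; ring.
have := v2 j; have := z2 x; rewrite ler_norml.
by move=> ? ?; apply/andP; split; lra.
Qed.

(** At scale [1] the scores themselves have a variance of order [ln k]. *)
Lemma chain_start_le c : bounded_coords c -> (forall t, scaled 1 (c t)) ->
  mean (@iid R T n p) (fun t => level_gap 1 (c t) t) <= 9 * u.
Proof.
move=> c2 sc.
pose D (th : signs) x := score (decode 1 th) (z x).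
pose kappa : R := 151 / 150 * (k%:R * (5 / 4) / (2 * 1 ^+ 2)).
pose sigma2 : R := 20 * ln (2 * k%:R) + 25 / 2.
have kappa0 : 0 < kappa by rewrite /kappa !mulr_gt0// ?invr_gt0 ?mulr_gt0 ?exprn_gt0.
have sigma0 : 0 < sigma2 by rewrite addr_gt0 ?mulr_gt0// invr_gt0.
apply: (@le_trans _ _ (Num.sqrt (2 * kappa * sigma2 / n%:R))).
  apply: (@pac_bayes R T _ n p (@fair_signs R ('I_k * A)%type)
    (fun t => level 1 (c t)) D kappa sigma2) => //.
  - exact: fairP.1.
  - exact: fairP.2.
  - by move=> t; exact: level_dist.
  - by move=> t y; exact: level_gt0.
  - by move=> t; exact: level_entropy_le (sc t) (c2 t).
  - move=> t x.
    apply: (@le_trans _ _ (mean (level 1 (c t)) (fun th =>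
        2 * (score (decode 1 th) (z x) - score (c t) (z x)) ^+ 2 + 25 / 2))).
      apply: ler_mean => [|th]; first exact: level_dist.
      have : score (c t) (z x) ^+ 2 <= (5 / 2) ^+ 2.
        rewrite -[leLHS]real_normK ?num_real// ler_sqr ?nnegrE ?divr_ge0//.
        exact: score_abs_le.
      rewrite /D; set a := score (decode 1 th) (z x); set b := score (c t) (z x).
      by have := sqr_ge0 (a - 2 * b); nra.
    rewrite meanD (mean_cst _ (level_dist (sc t))) meanZ /sigma2 lerD2r.
    have := level_score_var (sc t) (z2 x); rewrite expr1n mulr1; lra.
apply: sqrt_le_u => //; rewrite u2.
have -> : 2 * kappa * sigma2 / n%:R = 151 / 150 * (5 / 4) *
    (20 * (k%:R * ln (2 * k%:R) / n%:R) + 25 / 2 * (k%:R / n%:R)).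
  by rewrite /kappa /sigma2; field; rewrite !gt_eqF.
have : k%:R * ln (2 * k%:R) / n%:R <= k%:R * (2 * ln k%:R) / n%:R :> R.
  by rewrite ler_pM2r ?invr_gt0// ler_pM2l.
have -> : k%:R * (2 * ln k%:R) / n%:R = 2 * (k%:R * ln k%:R / n%:R) :> R by ring.
have : k%:R / n%:R * (69 / 100) <= k%:R * ln k%:R / n%:R :> R.
  rewrite mulrAC ler_pM2r ?invr_gt0// ler_pM2l//.
have : 0 <= k%:R * ln k%:R / n%:R :> R by rewrite -u2 sqr_ge0.
lra.
Qed.

(** Below the scale [sqrt (k / n)] the mean score is uniformly close to the
    unperturbed one, and no cancellation between the law and the sample is
    needed. *)
Lemma chain_end_le s v t : (forall j, \sum_a v j a ^+ 2 <= 5 / 4) ->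
  scaled s v -> s ^+ 2 <= k%:R / n%:R ->
  gap p t (fun x => score v (z x)) - level_gap s v t <= 9 * u.
Proof.
move=> v2 sv sn; have s0 := sv.1.
rewrite /level_gap -(gap_mean p t (level s v) (fun th x => score (decode s th) (z x))).
rewrite -gapB.
have dev x : `|score v (z x) - mean (level s v) (fun th => score (decode s th) (z x))|
    <= 9 / 2 * u.
  have hl := level_dist sv.
  pose d th := score (decode s th) (z x) - score v (z x).
  have -> : score v (z x) - mean (level s v) (fun th => score (decode s th) (z x))
      = - mean (level s v) d.
    by rewrite /d meanB (mean_cst _ hl) opprB.
  rewrite normrN -sqrtr_sqr; apply: sqrt_le_u; first by rewrite divr_ge0.
  apply: le_trans (sqr_mean_le d hl) _.
  apply: le_trans (level_score_var sv (z2 x)) _.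
  apply: (@le_trans _ _ (10 * (k%:R / n%:R) * (2 * ln k%:R))).
    by apply: ler_pM => //; [rewrite mulr_ge0 ?sqr_ge0|exact: ltW|rewrite ler_pM2l].
  have : 0 <= u ^+ 2 by exact: sqr_ge0.
  rewrite u2.
  have -> : 10 * (k%:R / n%:R) * (2 * ln k%:R) = 20 * (k%:R * ln k%:R / n%:R) :> R by ring.
  lra.
have -> : 9 * u = 9 / 2 * u - - (9 / 2 * u) by field.
apply: gap_le => // x; rewrite -ler_norml; exact: dev.
Qed.

(** The levels [3 ^- m] lead from scale [1] to the scale [sqrt (k / n)], reached
    for [9 ^ N >= n / k]; the cost is one [chain_link_le] per level. *)
Lemma mean_gap_score_le N c : bounded_coords c ->
  (forall t, scaled (3 ^- N) (c t)) -> (n <= 9 ^ N * k)%N ->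
  mean (@iid R T n p) (fun t => gap p t (fun x => score (c t) (z x)))
    <= (17 * N%:R + 18) * u.
Proof.
move=> c2 sc nN.
have pos m : 0 < 3 ^- m :> R by rewrite invr_gt0 exprn_gt0.
have scm m : (m <= N)%N -> forall t, scaled (3 ^- m) (c t).
  move=> mN t; split=> // j a; apply: le_trans ((sc t).2 j a) _.
  rewrite ler_pM2r ?invr_gt0// lef_pV2 ?posrE ?exprn_gt0//.
  by rewrite ler_eXn2l ?ltr1n.
have chain m : (m <= N)%N ->
    mean (@iid R T n p) (fun t => level_gap (3 ^- m) (c t) t) <= (17 * m%:R + 9) * u.
  elim: m => [|m IHm] mN.
    rewrite mulr0 add0r expr0 invr1; apply: chain_start_le => // t.
    by have := scm _ mN t; rewrite expr0 invr1.
  have := chain_link_le c2 (scm _ mN).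
  have -> : 3 * 3 ^- m.+1 = 3 ^- m :> R by rewrite exprS invfM mulrA divff ?mul1r.
  rewrite meanB; have := IHm (ltnW mN); rewrite -[m.+1%:R]natr1; lra.
have hi := iid_dist n hp.
have e : mean (@iid R T n p) (fun t => gap p t (fun x => score (c t) (z x)) -
    level_gap (3 ^- N) (c t) t) <= 9 * u.
  apply: mean_le => // t; apply: (chain_end_le t (c2 t) (sc t)).
  rewrite exprVn -exprM mulnC exprM -natrX ler_pdivlMr// mulrC ler_pdivrMr ?exprn_gt0 ?ltr0n//.
  by rewrite -natrX -natrM ler_nat mulnC.
move: e; rewrite meanB; have := chain N (leqnn N); lra.
Qed.

End chaining.

(** * Coordinates in the Hilbert space *)

Section hilbert.
Context (R : realType) (H : completeNormedModType R) (ip : {dot H for idfun})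
  (Hip : norm_induced_by ip).
Implicit Types (x y : H).

Lemma ipC x y : ip x y = ip y x.
Proof. by rewrite hermC/= expr0 mul1r. Qed.

Lemma ipDl x y z : ip (x + y) z = ip x z + ip y z.
Proof. exact: linearDl. Qed.

Lemma ipBl x y z : ip (x - y) z = ip x z - ip y z.
Proof. exact: linearBl. Qed.

Lemma ipZl a x y : ip (a *: x) y = a * ip x y.
Proof. exact: linearZl_LR. Qed.

Lemma ipDr x y z : ip x (y + z) = ip x y + ip x z.
Proof. by rewrite ipC ipDl !(ipC x). Qed.

Lemma ipBr x y z : ip x (y - z) = ip x y - ip x z.
Proof. by rewrite ipC ipBl !(ipC x). Qed.

Lemma ipZr a x y : ip x (a *: y) = a * ip x y.
Proof. by rewrite ipC ipZl ipC. Qed.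

Lemma ip_suml (I : finType) (F : I -> H) y : ip (\sum_i F i) y = \sum_i ip (F i) y.
Proof. exact: linear_sumlz. Qed.

Lemma ip_sumr (I : finType) (F : I -> H) y : ip y (\sum_i F i) = \sum_i ip y (F i).
Proof. by rewrite ipC ip_suml; apply: eq_bigr => i _; rewrite ipC. Qed.

Lemma sqr_normD x y : `|x + y| ^+ 2 = `|x| ^+ 2 + 2 * ip x y + `|y| ^+ 2.
Proof. by rewrite -!Hip ipDl !ipDr (ipC y x); ring. Qed.

Lemma sqr_normB x y : `|x - y| ^+ 2 = `|x| ^+ 2 - 2 * ip x y + `|y| ^+ 2.
Proof. by rewrite -!Hip ipBl !ipBr (ipC y x); ring. Qed.

Lemma ip_le x y : ip x y <= `|x| * `|y|.
Proof.
have := sqr_normD x y; have : `|x + y| ^+ 2 <= (`|x| + `|y|) ^+ 2.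
  by rewrite ler_sqr ?nnegrE ?addr_ge0// ler_normD.
rewrite sqrrD -mulr_natl; lra.
Qed.

Lemma abs_ip_le x y : `|ip x y| <= `|x| * `|y|.
Proof.
rewrite ler_norml ip_le andbT lerNl.
have <- : ip (-1 *: x) y = - ip x y by rewrite ipZl mulN1r.
by apply: le_trans (ip_le _ _) _; rewrite scaleN1r normrN.
Qed.

Definition orthonormal_family (A : finType) (e : A -> H) :=
  forall a b, ip (e a) (e b) = (a == b)%:R.

Lemma ip_projection (A : finType) (e : A -> H) x b : orthonormal_family e ->
  ip (\sum_a ip x (e a) *: e a) (e b) = ip x (e b).
Proof.
move=> he; rewrite ip_suml (bigD1 b)//= ipZl he eqxx mulr1 big1 ?addr0// => a ab.
by rewrite ipZl he (negPf ab) mulr0.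
Qed.

Lemma bessel (A : finType) (e : A -> H) x : orthonormal_family e ->
  \sum_a ip x (e a) ^+ 2 <= `|x| ^+ 2.
Proof.
move=> he; set q := \sum_a ip x (e a) *: e a.
have : 0 <= `|x - q| ^+ 2 by exact: sqr_ge0.
have xq : ip x q = \sum_a ip x (e a) ^+ 2.
  by rewrite ip_sumr; apply: eq_bigr => a _; rewrite ipZr.
have qq : ip q q = \sum_a ip x (e a) ^+ 2.
  rewrite {2}/q ip_sumr; apply: eq_bigr => a _.
  by rewrite ipZr ip_projection.
rewrite sqr_normB xq -[`|q| ^+ 2]Hip qq; lra.
Qed.

(** Gram-Schmidt orthonormalization. *)
Lemma orthonormal_span (s : seq H) : exists (A : finType) (e : A -> H),
  orthonormal_family e /\ {in s, forall x, x = \sum_a ip x (e a) *: e a}.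
Proof.
elim: s => [|y s [A [e [he es]]]].
  by exists 'I_0, (fun=> 0); split=> // -[].
set r := y - \sum_a ip y (e a) *: e a.
have re b : ip r (e b) = 0 by rewrite ipBl ip_projection// subrr.
have [r0|r0] := eqVneq r 0.
  exists A, e; split=> // x; rewrite inE => /orP[/eqP ->|]; last exact: es.
  by apply/eqP; rewrite -subr_eq0; apply/eqP.
pose e' (i : A + unit) := match i with inl a => e a | inr _ => `|r|^-1 *: r end.
have rn : `|r| != 0 by rewrite normr_eq0.
exists (A + unit)%type, e'; split.
  move=> [a|[]] [b|[]]/=.
  - by rewrite he; congr (_%:R); apply/esym/inj_eq; move=> ? ? [].
  - by rewrite ipZr ipC re mulr0.
  - by rewrite ipZl re mulr0.
  - by rewrite ipZl ipZr Hip/=; field.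
move=> x; rewrite inE big_sumType/= [X in _ = _ + X](big_pred1 tt)/=; last by case.
move=> /orP[/eqP ->|xs].
  have yr : ip y r = `|r| ^+ 2.
    rewrite -Hip {2}/r ipBl ip_suml big1 ?subr0// => a _.
    by rewrite ipZl (ipC (e a)) re mulr0.
  rewrite ipZr yr scalerA (_ : _ * _ = 1); last by field.
  by rewrite scale1r /r addrC subrK.
have xr : ip x r = 0.
  rewrite (es _ xs) ip_suml big1// => a _.
  by rewrite ipZl (ipC (e a)) re mulr0.
by rewrite -es// ipZr xr mulr0 scale0r addr0.
Qed.

(** * The expected supremum for finitely supported laws *)

Section finite_support.
Context (k : nat) (k2 : (2 <= k)%N) (T : finType) (n : nat) (n0 : (0 < n)%N)
  (p : T -> R) (hp : is_dist p) (B : R) (B0 : 0 < B) (y : T -> H)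
  (yB : forall x : T, `|y x| <= B).

(** Since [`|c| ^+ 2 - 2 * ip c x] is [B ^+ 2] times
    [1 / 2 - 2 * (ip (c / B) (x / B) - (`|c / B| ^+ 2 - 1 / 2) / 2)], the loss is
    linear in the vector [c / B] extended by the coordinate
    [`|c / B| ^+ 2 - 1 / 2]; subtracting [1 / 2] keeps the squared norms below
    [5 / 4].  Every coordinate is then split into [q ^ 2] equal ones, which
    changes no inner product and makes all coordinates small. *)
Lemma mean_gap_linear_le N (c : n.-tuple T -> 'I_k -> H) :
  (forall t j, `|c t j| <= B) -> (n <= 9 ^ N * k)%N ->
  mean (@iid R T n p) (fun t => gap p t (fun x : T => linear_loss ip (c t) (y x)))
  <= B ^+ 2 * ((17 * N%:R + 18) * Num.sqrt (k%:R * ln k%:R / n%:R)).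
Proof.
move=> cB nN.
have [A [e [he es]]] := orthonormal_span (map y (enum T)).
have yE (x : T) : y x = \sum_a ip (y x) (e a) *: e a.
  by apply: es; apply: map_f; rewrite mem_enum.
pose q := (20 * 3 ^ N)%N.
have q0 : 0 < q%:R :> R by rewrite ltr0n muln_gt0 expn_gt0.
pose ext (w : H) (b : R) (i : (A + unit) * 'I_(q * q)) : R :=
  match i.1 with inl a => ip w (e a) / B | inr _ => b end / q%:R.
pose v t j := ext (c t j) (`|c t j| ^+ 2 / B ^+ 2 - 1 / 2).
pose z (x : T) := ext (y x) (- (1 / 2)).
have B2 : 0 < B ^+ 2 by rewrite exprn_gt0.
have ext_sum w b w' b' : \sum_i ext w b i * ext w' b' i =
    B ^- 2 * \sum_a ip w (e a) * ip w' (e a) + b * b'.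
  have -> : \sum_i ext w b i * ext w' b' i = \sum_(i : A + unit) \sum_(l < q * q)
      ext w b (i, l) * ext w' b' (i, l) by rewrite pair_bigA; apply: eq_bigr => -[].
  rewrite big_sumType/= [X in _ + X](big_pred1 tt)/=; last by case.
  congr (_ + _).
    rewrite mulr_sumr; apply: eq_bigr => a _.
    rewrite /ext/= sumr_const card_ord -(mulr_natl (_ * _)) natrM.
    by field; rewrite !gt_eqF.
  rewrite /ext/= sumr_const card_ord -(mulr_natl (_ * _)) natrM.
  by field; rewrite !gt_eqF.
have ext2 w b : \sum_i ext w b i ^+ 2 <= B ^- 2 * `|w| ^+ 2 + b ^+ 2.
  have -> : \sum_i ext w b i ^+ 2 = \sum_i ext w b i * ext w b i by [].
  rewrite ext_sum -expr2 lerD2r ler_pM2l ?invr_gt0//.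
  exact: bessel.
have unit_ratio (w : H) : `|w| <= B -> 0 <= `|w| ^+ 2 / B ^+ 2 <= 1.
  move=> wB; rewrite divr_ge0 ?sqr_ge0//= ler_pdivrMr// mul1r.
  by rewrite ler_sqr ?nnegrE// ltW.
have v2 : bounded_coords v.
  move=> t j; apply: le_trans (ext2 _ _) _.
  have /andP[] := unit_ratio _ (cB t j).
  rewrite [_ ^- 2 * _]mulrC; set r := `|c t j| ^+ 2 / B ^+ 2 => r0 r1; nra.
have z2 (x : T) : \sum_a z x a ^+ 2 <= 5 / 4.
  apply: le_trans (ext2 _ _) _.
  by have /andP[] := unit_ratio _ (yB x); rewrite [_ ^- 2 * _]mulrC; lra.
have vs t : scaled (3 ^- N) (v t).
  split=> [|j i]; first by rewrite invr_gt0 exprn_gt0.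
  have e1 a : `|e a| = 1.
    by apply/eqP; rewrite -sqrp_eq1// -Hip he eqxx.
  have -> : 3 ^- N / 10 = 2 / q%:R :> R.
    by rewrite /q natrM natrX; field; rewrite gt_eqF// exprn_gt0.
  rewrite /v /ext normrM normfV (gtr0_norm q0) ler_pM2r ?invr_gt0//.
  case: (i.1) => [a|_].
    rewrite normrM normfV (gtr0_norm B0) ler_pdivrMr//.
    apply: le_trans (abs_ip_le _ _) _; rewrite e1 mulr1.
    by apply: le_trans (cB t j) _; rewrite ler_peMl ?ler1n // ltW.
  by have /andP[? ?] := unit_ratio _ (cB t j); rewrite ler_norml; apply/andP; split; lra.
have main := mean_gap_score_le k2 n0 hp z2 v2 vs nN.
have lossE t (x : T) : linear_loss ip (c t) (y x) = B ^+ 2 / 2 + B ^+ 2 * score (v t) (z x).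
  rewrite /linear_loss /score -min_family_affine; [|exact: ltnW|exact: ltW].
  congr min_family; apply/funext => j.
  rewrite ext_sum.
  have -> : \sum_a ip (c t j) (e a) * ip (y x) (e a) = ip (c t j) (y x).
    rewrite [in RHS]yE ip_sumr; apply: eq_bigr => a _.
    by rewrite ipZr mulrC.
  by field; rewrite gt_eqF.
have -> : mean (@iid R T n p) (fun t => gap p t (fun x : T => linear_loss ip (c t) (y x)))
  = B ^+ 2 * mean (@iid R T n p) (fun t => gap p t (fun x : T => score (v t) (z x))).
  rewrite -meanZ; apply: eq_mean => t.
  by rewrite (eq_gap _ _ (lossE t)) gapD gap_cst// add0r gapZ.
by rewrite ler_pM2l.
Qed.

End finite_support.

End hilbert.

(** * Comparison of the numerical bounds *)

(** With [ell = ln (n / k)] the product [rate * sharp_factor] is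
    [u * (6 * sqrt 2 * ell / ln 2 + 6 + third)].  Chaining costs
    [(17 * N + 18) * u] with [N <= 1 + ell / (3 * ln 2)], because
    [9 >= 2 ^ 3]: this is smaller once [ell >= 8 * ln 2], while for
    [ell <= 8 * ln 2] the product is at least [4], the oscillation of the losses
    in units of [B ^+ 2]. *)
Section rates.
Context (R : realType) (n k : nat) (k2 : (2 <= k)%N) (nk : (2 * k <= n)%N).

Let ell : R := ln (n%:R / k%:R).
Let u : R := Num.sqrt (k%:R * ln k%:R / n%:R).
Let third : R := Num.sqrt (2 * (Num.sqrt 2 + 1) * (17 + 9 * ln k%:R) / ln k%:R).

Let kR : 0 < k%:R :> R. Proof. by rewrite ltr0n; exact: ltn_trans k2. Qed.

Let nR : 0 < n%:R :> R.
Proof.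
by rewrite ltr0n; apply: leq_trans nk; rewrite muln_gt0/=; exact: ltn_trans k2.
Qed.

Let ln2 : 69 / 100 <= ln 2 :> R. Proof. exact: ln2_ge. Qed.

Let lnk : 69 / 100 <= ln k%:R :> R.
Proof. by apply: le_trans ln2 _; rewrite ler_ln ?posrE// ler_nat. Qed.

Let ell_ge : ln 2 <= ell.
Proof.
rewrite /ell ler_ln ?posrE ?divr_gt0// ler_pdivlMr//.
by rewrite -natrM ler_nat.
Qed.

Let ell_gt0 : 0 < ell.
Proof. by apply: lt_le_trans ell_ge; apply: lt_le_trans ln2; rewrite divr_gt0. Qed.

Lemma sqrt2_bounds : 1414 / 1000 <= Num.sqrt (2 : R) <= 2829 / 2000.
Proof.
have pos (m q : nat) : 0 <= m%:R / q%:R :> R by rewrite divr_ge0.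
have s0 : 0 <= Num.sqrt 2 :> R by exact: sqrtr_ge0.
have s2 : Num.sqrt 2 ^+ 2 = 2 :> R by rewrite sqr_sqrtr.
by apply/andP; split; rewrite -ler_sqr ?nnegrE// s2; lra.
Qed.

Lemma leading_constant_le : 6 * Num.sqrt 2 / ln 2 <= 123 / 10 :> R.
Proof.
have l2 := ln2; have lk := lnk; have e0 := ell_gt0.
have /andP[_ h] := sqrt2_bounds.
by rewrite ler_pdivrMr; lra.
Qed.

Let third_ge : 13 / 2 <= third.
Proof.
have l2 := ln2; have lk := lnk; have e0 := ell_gt0.
have -> : 13 / 2 = Num.sqrt ((13 / 2) ^+ 2) :> R by rewrite sqrtr_sqr ger0_norm.
rewrite ler_wsqrtr// ler_pdivlMr; last lra.
have /andP[h _] := sqrt2_bounds; nra.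
Qed.

Let third_le : third <= 14.
Proof.
have l2 := ln2; have lk := lnk; have e0 := ell_gt0.
have -> : 14 = Num.sqrt (14 ^+ 2) :> R by rewrite sqrtr_sqr ger0_norm.
rewrite ler_wsqrtr// ler_pdivrMr; last lra.
have /andP[_ h] := sqrt2_bounds; nra.
Qed.

Let u_ge0 : 0 <= u. Proof. exact: sqrtr_ge0. Qed.

(* [83 / 100] is below the square root of [ln 2] *)
Let u_expR : 83 / 100 <= u * expR (ell / 2).
Proof.
have l2 := ln2; have lk := lnk; have e0 := ell_gt0.
have E0 := expR_gt0 (ell / 2).
rewrite -ler_sqr ?nnegrE ?mulr_ge0 ?divr_ge0 ?(ltW E0)//.
have -> : (u * expR (ell / 2)) ^+ 2 = expR ell * u ^+ 2.
  rewrite exprMn mulrC -expRM_natl; congr (expR _ * _).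
  by rewrite mulrC divfK.
rewrite lnK ?posrE ?divr_gt0//.
rewrite sqr_sqrtr; last by rewrite divr_ge0 ?mulr_ge0 ?(ltW kR) ?(ltW nR)//; lra.
have -> : n%:R / k%:R * (k%:R * ln k%:R / n%:R) = ln k%:R :> R.
  by field; rewrite !gt_eqF.
lra.
Qed.

Lemma expR_le_chord (x y : R) : 0 <= x -> x <= y -> 0 < y ->
  expR x <= 1 + x / y * (expR y - 1).
Proof.
move=> x0 xy y0; set s := x / y.
have s0 : 0 <= s by rewrite divr_ge0 // ltW.
have s1 : s <= 1 by rewrite ler_pdivrMr// mul1r.
have sE : s * y = x by rewrite divfK// gt_eqF.
have E0 := expR_gt0 x.
have h1 : expR x * (1 - x) <= 1.
  have := ler_wpM2l (ltW E0) (expR_ge1Dx (- x)); rewrite expRxMexpNx_1; lra.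
have h2 : expR x * (1 + (y - x)) <= expR y.
  have := ler_wpM2l (ltW E0) (expR_ge1Dx (y - x)).
  by rewrite -expRD [x + _]addrC subrK.
have s1' : 0 <= 1 - s by lra.
have := lerD (ler_wpM2l s1' h1) (ler_wpM2l s0 h2).
have -> : (1 - s) * (expR x * (1 - x)) + s * (expR x * (1 + (y - x))) =
   expR x * (1 - x + s * y) by ring.
rewrite sE => h; rewrite -/s.
have e : expR x * (1 - x + x) = expR x by ring.
by move: h; rewrite e; lra.
Qed.

Let expR_ell_le m : 0 < m -> ell <= 2 * m * ln 2 ->
  expR (ell / 2) <= 1 + ell / (2 * m * ln 2) * (expR (m * ln 2) - 1).
Proof.
have l2 := ln2; have lk := lnk; have e0 := ell_gt0.
move=> m0 em; have := @expR_le_chord (ell / 2) (m * ln 2).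
have -> : ell / 2 / (m * ln 2) = ell / (2 * m * ln 2).
  by field; rewrite !gt_eqF//; lra.
have m2 : 0 < m * ln 2 by rewrite mulr_gt0//; lra.
apply=> //; first by apply: divr_ge0 => //; exact: ltW.
lra.
Qed.

Let expR_ln2 m : expR (m%:R * ln 2) = 2 ^+ m :> R.
Proof. by rewrite expRM_natl lnK// posrE. Qed.

(** On [[ln 2, 8 * ln 2]] the convex function [expR (ell / 2)] lies below two
    chords starting at [0], hence below a multiple of [ell]. *)
Lemma rate_gt_small : ell <= 8 * ln 2 -> 1 / 4 < rate R n k.
Proof.
have l2 := ln2; have lk := lnk; have e0 := ell_gt0.
move=> e8; have E0 := expR_gt0 (ell / 2).
suff h : expR (ell / 2) < 332 / 100 * ell.
  rewrite /rate -/ell -/u -(ltr_pM2r E0) -mulrA.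
  by have := ler_wpM2l (ltW ell_gt0) u_expR; lra.
have [e4|e4] := leP ell (4 * ln 2).
  have := @expR_ell_le 2 ltac:(lra) ltac:(lra); rewrite (expR_ln2 2).
  have -> : ell / (2 * 2 * ln 2) * (2 ^+ 2 - 1) = (3 / 4) * (ell / ln 2) by field; rewrite gt_eqF//; lra.
  have : ell / ln 2 <= ell / (69 / 100).
    by rewrite ler_pM2l// lef_pV2 ?posrE//; lra.
  by have := ell_ge; lra.
have := @expR_ell_le 4 ltac:(lra) ltac:(lra); rewrite (expR_ln2 4).
have -> : ell / (2 * 4 * ln 2) * (2 ^+ 4 - 1) = (15 / 8) * (ell / ln 2) by field; rewrite gt_eqF//; lra.
have : ell / ln 2 <= ell / (69 / 100).
  by rewrite ler_pM2l// lef_pV2 ?posrE//; lra.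
lra.
Qed.

Lemma sharp_factor_le : 16 * rate R n k <= 4 -> sharp_factor R n k <= 16.
Proof.
have t1 := third_ge; have t2 := third_le.
have l2 := ln2; have lk := lnk; have e0 := ell_gt0.
move=> r16; have e8 : 8 * ln 2 <= ell.
  rewrite leNgt; apply/negP => /ltW /rate_gt_small; lra.
rewrite /sharp_factor -/ell -/third.
have h := leading_constant_le.
have -> : 6 * Num.sqrt 2 / ln 2 + 6 / ell + ell^-1 * third =
  6 * Num.sqrt 2 / ln 2 + (6 + third) / ell by ring.
have : (6 + third) / ell <= 37 / 10 by rewrite ler_pdivrMr//; lra.
lra.
Qed.

Let rate_sharpE : rate R n k * sharp_factor R n k =
  u * (6 * Num.sqrt 2 * (ell / ln 2) + 6 + third).
Proof.
have l2 := ln2; have lk := lnk; have e0 := ell_gt0.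
rewrite /rate /sharp_factor -/ell -/u -/third; field.
by rewrite !gt_eqF//; lra.
Qed.

Lemma rate_sharp_ge4 : ell <= 8 * ln 2 -> 4 <= rate R n k * sharp_factor R n k.
Proof.
have t1 := third_ge; have t2 := third_le.
have l2 := ln2; have lk := lnk; have e0 := ell_gt0.
move=> e8; have E0 := expR_gt0 (ell / 2).
have /andP[s2 _] := sqrt2_bounds.
have rsE := rate_sharpE; set L := ell / ln 2 in rsE *.
have L0 : 0 <= L by rewrite divr_ge0//; lra.
have L8 : L <= 8 by rewrite ler_pdivrMr; lra.
have h : expR (ell / 2) <= 1 + 15 / 8 * L.
  have := @expR_ell_le 4 ltac:(lra) ltac:(lra); rewrite (expR_ln2 4).
  have -> : ell / (2 * 4 * ln 2) * (2 ^+ 4 - 1) = (15 / 8) * (ell / ln 2) by field; rewrite gt_eqF//; lra.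
  by [].
rewrite rsE -(ler_pM2r E0) mulrAC.
apply: (@le_trans _ _ (83 / 100 * (6 * Num.sqrt 2 * L + 6 + third))); last first.
  rewrite ler_wpM2r//; have sL : 0 <= Num.sqrt 2 * L by rewrite mulr_ge0 ?sqrtr_ge0.
  lra.
have : 1414 / 1000 * L <= Num.sqrt 2 * L by rewrite ler_wpM2r.
lra.
Qed.

Lemma chain_bound_le_rate : 8 * ln 2 <= ell ->
  exists2 N, (n <= 9 ^ N * k)%N &
    (17 * N%:R + 18) * u <= rate R n k * sharp_factor R n k.
Proof.
have t1 := third_ge; have t2 := third_le.
have l2 := ln2; have lk := lnk; have e0 := ell_gt0.
move=> e8.
have exN : exists N, (n <= 9 ^ N * k)%N.
  exists n; apply: leq_trans (leq_pmulr _ _); last exact: ltn_trans k2.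
  exact/ltnW/ltn_expl.
case: (ex_minnP exN) => N nN Nmin; exists N => //.
rewrite rate_sharpE mulrC ler_wpM2l//.
have /andP[s2 _] := sqrt2_bounds.
set L := ell / ln 2.
have L8 : 8 <= L by rewrite ler_pdivlMr; lra.
have NL : N%:R <= 1 + L / 3.
  case: N nN Nmin => [|N] nN Nmin; first lra.
  have : (9 ^ N * k < n)%N by rewrite ltnNge; apply/negP => /Nmin; rewrite ltnn.
  move=> h; rewrite -natr1 addrC lerD2l /L.
  have -> : ell / ln 2 / 3 = ell / (3 * ln 2) by field; rewrite gt_eqF//; lra.
  rewrite ler_pdivlMr ?mulr_gt0//; last by apply: lt_le_trans l2; rewrite divr_gt0.
  have -> : N%:R * (3 * ln 2) = ln ((2 ^+ 3) ^+ N) :> R.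
    by rewrite lnXn ?exprn_gt0// lnXn// -(mulr_natl (ln 2 *+ 3)) -(mulr_natl (ln 2)).
  rewrite ler_ln ?posrE ?divr_gt0 ?exprn_gt0// ler_pdivlMr//.
  rewrite -natrX -natrX -natrM ler_nat; apply: leq_trans (ltnW h).
  by rewrite leq_mul2r; apply/orP; right; case: (N) => // m; rewrite leq_exp2r.
have : 1414 / 1000 * L <= Num.sqrt 2 * L by rewrite ler_wpM2r//; lra.
have -> : 6 * Num.sqrt 2 * L = 6 * (Num.sqrt 2 * L) by ring.
lra.
Qed.

End rates.

(** * Uniform deviations over a finite probability space *)

Section uniform_deviation.
Context (R : realType) (T : finType) (n : nat) (n0 : (0 < n)%N) (p : T -> R)
  (hp : is_dist p) (C : Type) (S : set C) (f : C -> T -> R) (b K : R).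

Lemma gap_le_oscillation (t : n.-tuple T) (g : T -> R) :
  (forall x y, g x - g y <= b) -> gap p t g <= b.
Proof.
move=> gb; rewrite /gap lerBlDr.
have h y : mean p g <= b + g y by apply: mean_le => // x; rewrite -lerBlDr.
rewrite -lerBlDl -lerN2 -mulrN -sumrN opprB.
apply: (@empirical_mean_le _ _ _ t (fun x => - g x)) => // y.
by have := h y; lra.
Qed.

Lemma gap_bounded_differences (t t' : n.-tuple T) (g : T -> R) i :
  (forall x y, g x - g y <= b) -> (forall j, j != i -> tnth t j = tnth t' j) ->
  gap p t g - gap p t' g <= b / n%:R.
Proof.
move=> gb tt'.
have nR : 0 < n%:R :> R by rewrite ltr0n.
have -> : gap p t g - gap p t' g = (g (tnth t' i) - g (tnth t i)) / n%:R.
  rewrite /gap (bigD1 i)//= [X in _ - (_ - _ * X)](bigD1 i)//=.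
  have -> : \sum_(j < n | j != i) g (tnth t j) = \sum_(j < n | j != i) g (tnth t' j).
    by apply: eq_bigr => j /tt' ->.
  by field; rewrite gt_eqF.
by rewrite ler_pM2r ?invr_gt0.
Qed.

Context (S0 : S !=set0) (b0 : 0 <= b)
  (fb : forall c, S c -> forall x y, f c x - f c y <= b)
  (fK : forall c : n.-tuple T -> C, (forall t, S (c t)) ->
    mean (@iid R T n p) (fun t => gap p t (f (c t))) <= K).

(** Choosing for each sample a near maximizer turns a bound on all
    sample-dependent choices into a bound on the mean of the supremum, around
    which the supremum concentrates by [mcdiarmid]. *)
Lemma uniform_deviation : exists Z : n.-tuple T -> R,
  [/\ forall t c, S c -> gap p t (f c) <= Z t,
      mean (@iid R T n p) Z <= K &
      forall delta, 0 < delta < 1 ->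
        1 - delta <= \sum_(t | Z t <= K + b * Num.sqrt (ln delta^-1 / (2 * n%:R))) iid p t].
Proof.
have nR : 0 < n%:R :> R by rewrite ltr0n.
have hi := iid_dist n hp.
pose G (t : n.-tuple T) := [set gap p t (f c) | c in S].
pose Z t := sup (G t).
have G0 t : has_sup (G t).
  split; first by case: S0 => c Sc; exists (gap p t (f c)); exists c.
  by exists b => _ [c Sc <-]; apply: gap_le_oscillation; exact: fb.
have gapZ t c : S c -> gap p t (f c) <= Z t.
  by move=> Sc; apply: ub_le_sup; [exact: (G0 t).2|exists c].
have mZ : mean (@iid R T n p) Z <= K.
  apply/ler_addgt0Pr => e e0.
  have ex t : exists c, S c /\ Z t - e < gap p t (f c).
    by have [_ [c Sc <-] h] := sup_adherent e0 (G0 t); exists c.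
  have /choice [c cP] := ex.
  have := fK (fun t => (cP t).1).
  have : mean (@iid R T n p) (fun t => Z t - e) <=
      mean (@iid R T n p) (fun t => gap p t (f (c t))).
    by apply: ler_mean => // t; exact: ltW (cP t).2.
  by rewrite meanB mean_cst//; lra.
exists Z; split=> // delta d01.
have sub (P Q : pred (n.-tuple T)) : (forall t, P t -> Q t) ->
    \sum_(t | P t) iid p t <= \sum_(t | Q t) iid p t :> R.
  move=> PQ; rewrite [leRHS](bigID P)/= -[leLHS]addr0 lerD//; last first.
    by apply: sumr_ge0 => t _; exact: hi.1.
  by rewrite le_eqVlt; apply/orP; left; apply/eqP/eq_bigl => t;
    case Pt: (P t); rewrite ?andbF ?andbT//; rewrite (PQ _ Pt).
have [b_gt0|b_le0] := ltP 0 b; last first.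
  have be : b = 0 by apply/le_anti; rewrite b_le0.
  have [c0 Sc0] := S0.
  have gap0 (t : n.-tuple T) c : S c -> gap p t (f c) <= 0.
    by rewrite -be => Sc; apply: gap_le_oscillation; exact: fb.
  have Z0 t : Z t <= 0.
    by apply: sup_le_ub => [|_ [c Sc <-]]; [exact: (G0 t).1|exact: gap0].
  have K0 : 0 <= K.
    by have := fK (fun=> Sc0); rewrite mean_gap0.
  rewrite be mul0r addr0 (eq_bigl predT); last first.
    by move=> t; rewrite (le_trans (Z0 t)).
  by rewrite hi.2; case/andP: d01 => d0 _; lra.
have bd : bounded_differences Z (b / n%:R).
  move=> t t' i tt'; rewrite lerBlDr; apply: sup_le_ub => [|_ [c Sc <-]].
    exact: (G0 t).1.
  have := gap_bounded_differences (fb Sc) tt'.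
  by have := gapZ t' _ Sc; lra.
have bn : 0 < b / n%:R by rewrite divr_gt0.
apply: le_trans (mcdiarmid hp bn bd n0 d01) _.
apply: sub => t /le_trans; apply; apply: lerD => //.
rewrite -mulrA ler_pM2l//.
have -> : n%:R * ln delta^-1 / 2 = n%:R ^+ 2 * (ln delta^-1 / (2 * n%:R)).
  by field; rewrite gt_eqF.
by rewrite sqrtrM ?sqr_ge0// sqrtr_sqr gtr0_norm// mulKf// gt_eqF.
Qed.

End uniform_deviation.

(** * Finitely valued functions on a probability space *)

Section finitely_valued.
Context (d : measure_display) (E : measurableType d) (R : realType)
  (mu : probability E R) (T : finType) (q : E -> T)
  (mq : forall j, measurable (q @^-1` [set j])).

(** The push-forward of [mu] by [q], as a family of weights. *)
Definition law (j : T) : R := fine (mu (q @^-1` [set j])).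

Lemma lawE j : (law j)%:E = mu (q @^-1` [set j]).
Proof. by rewrite fineK// fin_num_measure. Qed.

Lemma measurable_preimage (A : set T) : measurable (q @^-1` A).
Proof.
have -> : q @^-1` A = \bigcup_(j in A) (q @^-1` [set j]).
  apply/seteqP; split=> [x Ax|x [j Aj qx]]; first by exists (q x).
  by rewrite /preimage/= qx.
apply: fin_bigcup_measurable => //; exact: finite_finset.
Qed.

Lemma measurable_fun_finite (g : T -> R) : measurable_fun setT (fun x => g (q x)).
Proof.
move=> _ Y mY; rewrite setTI.
exact: (measurable_preimage (g @^-1` Y)).
Qed.

Lemma integrable_finite (g : T -> R) : mu.-integrable setT (fun x => (g (q x))%:E).
Proof.
apply: measurable_bounded_integrable => //.
- exact: fin_num_fun_lty.
- exact: measurable_fun_finite.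
- exists (\sum_j `|g j|); split=> [|M hM x _]; first exact: num_real.
  apply: le_trans (ltW hM); rewrite (bigD1 (q x))//= lerDl.
  exact: sumr_ge0.
Qed.

Lemma integral_finite (g : T -> R) :
  (\int[mu]_x (g (q x))%:E = (mean law g)%:E)%E.
Proof.
have -> : (fun x => (g (q x))%:E) =
    (fun x => \sum_(j : T) (g j)%:E * (\1_(q @^-1` [set j]) x)%:E)%E.
  apply/funext => x; rewrite (bigD1 (q x))//= big1 ?adde0.
    by rewrite indicE mem_set// mule1.
  by move=> j /eqP jx; rewrite indicE memNset ?mule0//= => /esym.
have mI j : mu.-integrable setT (fun x => (\1_(q @^-1` [set j]) x)%:E).
  by apply: integrable_indic.
rewrite integral_sum//; last by move=> j; exact: integrableZl.
rewrite /mean -sumEFin; apply: eq_bigr => j _.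
by rewrite integralZl// integral_indic// setIT EFinM lawE muleC.
Qed.

Lemma law_dist : is_dist law.
Proof.
split=> [j|]; first by rewrite fine_ge0.
have := integral_finite (fun=> 1); rewrite integral_cst// mul1e.
move=> /(etrans (esym (probability_setT mu)))[->].
by apply: eq_bigr => j _; rewrite mulr1.
Qed.

Lemma measure_preimage (A : pred T) :
  mu (q @^-1` [set j | A j]) = (\sum_(j | A j) law j)%:E.
Proof.
have mA := measurable_preimage [set j | A j].
have <- : (\int[mu]_x (\1_(q @^-1` [set j | A j]) x)%:E = mu (q @^-1` [set j | A j]))%E.
  by rewrite integral_indic// setIT.
have := integral_finite (fun j => (A j)%:R).
have -> : mean law (fun j => (A j)%:R) = \sum_(j | A j) law j.
  rewrite /mean [RHS]big_mkcond; apply: eq_bigr => j _.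
  by case: (A j); rewrite ?mulr1 ?mulr0.
move=> <-; apply: eq_integral => x _; rewrite indicE.
by congr ((_ : bool)%:R%:E); apply/idP/idP => [/set_mem|h]; last exact/mem_set.
Qed.

Section approximation.
Context (D : set E) (mD : measurable D) (D1 : mu D = 1%E) (f : E -> R)
  (mf : measurable_fun setT f) (g r : T -> R) (r0 : forall j, 0 <= r j)
  (fg : forall x, D x -> `|f x - g (q x)| <= r (q x)).

(** Off the event [D] of full measure, [f] is replaced by [g (q x)], which does
    not change its integral. *)
Lemma integral_approx : mu.-integrable setT (EFin \o f) /\
  exists2 I : R, (\int[mu]_x (f x)%:E = I%:E)%E & `|I - mean law g| <= mean law r.
Proof.
pose f' x := \1_D x * f x + \1_(~` D) x * g (q x).
have fD x : D x -> f' x = f x.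
  by move=> Dx; rewrite /f' !indicE mem_set// memNset ?mul1r ?mul0r ?addr0//=; exact.
have fND x : ~ D x -> f' x = g (q x).
  by move=> Dx; rewrite /f' !indicE memNset// mem_set// mul1r mul0r add0r.
have f'g x : `|f' x - g (q x)| <= r (q x).
  have [Dx|Dx] := pselect (D x); first by rewrite fD// fg.
  by rewrite fND// subrr normr0.
have mf' : measurable_fun setT f'.
  apply: measurable_funD; apply: measurable_funM => //.
  - exact/measurable_indic/measurableC.
  - exact: measurable_fun_finite.
have ae_f : ae_eq mu setT (EFin \o f) (EFin \o f').
  exists (~` D); split.
  - exact: measurableC.
  - by apply: (etrans (probability_setC mu mD)); rewrite D1 subee.
  - move=> x /= h; have [Dx|//] := pselect (D x); exfalso; apply: h => _.
    by rewrite fD.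
have f'int : mu.-integrable setT (EFin \o f').
  apply: measurable_bounded_integrable => //.
    exact: fin_num_fun_lty.
  exists (\sum_j (`|g j| + r j)); split=> [|M hM x _]; first exact: num_real.
  apply: le_trans (ltW hM); rewrite (bigD1 (q x))//=.
  apply: ler_wpDr; first by apply: sumr_ge0 => j _; rewrite addr_ge0.
  rewrite -[X in `|X|](subrK (g (q x))) addrC.
  by apply: le_trans (ler_normD _ _) _; rewrite lerD2l.
have fint : mu.-integrable setT (EFin \o f).
  apply/integrableP; split; first exact/measurable_EFinP.
  have /integrableP [_] := f'int; congr (_ < _)%E.
  apply: ae_eq_integral => //.
  - by apply: measurableT_comp => //; exact/measurable_EFinP.
  - by apply: measurableT_comp => //; exact/measurable_EFinP.
  - case: ae_f => N [mN N0 sN]; exists N; split=> // x h; apply: sN => e.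
    apply: h => _; have /= [ex] := e Logic.I.
    by rewrite /= ex.
split=> //.
have fin : (\int[mu]_x (f x)%:E \is a fin_num)%E by exact: integrable_fin_num.
exists (fine (\int[mu]_x (f x)%:E)%E); first by rewrite fineK.
have eqf : (\int[mu]_x (f x)%:E = \int[mu]_x (f' x)%:E)%E.
  by apply: ae_eq_integral => //; exact/measurable_EFinP.
rewrite ler_norml; apply/andP; split.
- rewrite lerBrDl -lee_fin fineK// eqf -meanB -integral_finite.
  apply: le_integral => //; first exact: (integrable_finite (fun j => g j - r j)).
  move=> x _ /=; rewrite lee_fin.
  by have := f'g x; rewrite ler_norml => /andP[]; lra.
- rewrite lerBlDl -lee_fin fineK// eqf -meanD -integral_finite.
  apply: le_integral => //; first exact: (integrable_finite (fun j => g j + r j)).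
  move=> x _ /=; rewrite lee_fin.
  by have := f'g x; rewrite ler_norml => /andP[]; lra.
Qed.

End approximation.

End finitely_valued.

Section with_probability.
Context (d : measure_display) (Omega : measurableType d) (R : realType)
  (P : probability Omega R).
Implicit Types (A : set Omega).

Lemma with_probability_geS (p : R) A A' : A `<=` A' ->
  with_probability_ge P p A -> with_probability_ge P p A'.
Proof. by move=> AA' [E [mE EA pE]]; exists E; split=> // w /EA /AA'. Qed.

(** The witness is the limit superior of the witnesses. *)
Lemma with_probability_ge_limit (p : R) (F : nat -> set Omega) A :
  (forall m, with_probability_ge P (p - m.+1%:R^-1) (F m)) ->
  (forall w, (forall N, exists2 m, (N <= m)%N & F m w) -> A w) ->
  with_probability_ge P p A.
Proof.
move=> /choice[G GP] FA.
have mG m : measurable (G m) by case: (GP m).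
exists (lim_sup_set G); split.
- apply: bigcap_measurable => // m _; apply: bigcup_measurable => j _; exact: mG.
- move=> w Gw; apply: FA => N; have [m /= Nm Gm] := Gw N I.
  by exists m => //; case: (GP m) => _ + _; apply.
- have cv := @lim_sup_set_cvg _ _ _ P G mG.
  have mU : measurable (\bigcup_(j >= 0) G j).
    by apply: bigcup_measurable => j _; exact: mG.
  have {}cv := cv (le_lt_trans (probability_le1 P mU) (ltry _)).
  rewrite -(cvg_lim _ cv)//.
  apply: lime_ge; first by apply/cvg_ex; eexists; exact: cv.
  apply: nearW => N; apply/lee_addgt0Pr => e e0.
  have [m mN me] : exists2 m, (N <= m)%N & m.+1%:R^-1 <= e.
    exists (maxn N (Num.truncn e^-1)); first exact: leq_maxl.
    rewrite invf_ple ?posrE//; apply: ltW.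
    apply: lt_le_trans (truncnS_gt _) _.
    by rewrite ler_nat ltnS leq_maxr.
  rewrite -leeBlDr// -EFinB.
  apply: (@le_trans _ _ (P (G m))).
    by case: (GP m) => _ _; apply: le_trans; rewrite lee_fin lerB.
  apply: le_measure; rewrite ?inE//.
    by apply: bigcup_measurable => j _; exact: mG.
  by move=> w Gw; exists m.
Qed.

End with_probability.

(** * Quantization of the space *)

Section sample_law.
Context (d d' : measure_display) (Omega : measurableType d)
  (E : measurableType d') (R : realType) (P : probability Omega R)
  (n : nat) (X : {RV P >-> E}) (Xs : 'I_n -> {RV P >-> E})
  (hX : independent_copies X Xs) (T : finType) (q : E -> T)
  (mq : forall j, measurable (q @^-1` [set j])).

Definition quantized_sample (w : Omega) : n.-tuple T := [tuple q (Xs i w) | i < n].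

Lemma quantized_sample_fiber t : quantized_sample @^-1` [set t] =
  \bigcap_(i in [set i | i \in [set: 'I_n]%SET])
    (Xs i @^-1` (q @^-1` [set tnth t i])).
Proof.
apply/seteqP; split=> w /=.
  by move=> <- i _ /=; rewrite tnth_mktuple.
move=> h; apply: eq_from_tnth => i; rewrite tnth_mktuple.
by apply: h; rewrite /= inE.
Qed.

Lemma measurable_quantized_sample t : measurable (quantized_sample @^-1` [set t]).
Proof.
rewrite quantized_sample_fiber; apply: fin_bigcap_measurable.
  exact: finite_finset.
by move=> i _; exact: measurable_funPTI.
Qed.

(** Mutual independence enters the proof here only: the fibres of the quantized
    sample are intersections of events on the single observations. *)
Lemma law_quantized_sample t :
  law P quantized_sample t = iid (law (distribution P X) q) t.
Proof.
apply/EFin_inj; rewrite lawE; last exact: measurable_quantized_sample.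
rewrite quantized_sample_fiber.
rewrite (hX.1 [set: 'I_n]%SET (fun i => q @^-1` [set tnth t i]))//.
rewrite /iid -prodEFin; apply: eq_big => [i|i _]; first by rewrite inE.
by rewrite lawE//; exact: (hX.2 i _ (mq _)).
Qed.

End sample_law.

Section quantizer.
Context (R : realType) (H : completeNormedModType R) (Hsep : separable H)
  (mu : probability (borel H) R).

Lemma dense_sequence : exists s : nat -> H, dense (range s).
Proof.
case: Hsep => D cD dD.
have [f fD] := countable_injP _ cD.
pose s i := xget (0 : H) [set x | D x /\ f x = i].
exists s => O O0 oO; have [x [Ox Dx]] := dD O O0 oO.
exists x; split=> //; exists (f x) => //.
rewrite /s; case: xgetP => [z _ [Dz fz]|/(_ x)/= h].
  by apply: fD => //; rewrite inE.
by exfalso; apply: h.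
Qed.

Lemma measurable_open (A : set H) : open A -> measurable (A : set (borel H)).
Proof. by move=> oA; exact: sub_sigma_algebra. Qed.

(** Points are sent to the first of finitely many members of a dense sequence at
    distance less than [eta]; the last cell collects the points with none, and
    its mass is small for a long enough sequence.  The representative [y j] is
    taken in the cell and in the ball, hence the factor [2]. *)
Lemma quantizer (B eta : R) : 0 <= B -> 0 < eta ->
  exists (Q : nat) (q : borel H -> 'I_Q.+1) (y : 'I_Q.+1 -> H),
  [/\ forall j, measurable (q @^-1` [set j]),
      forall j, `|y j| <= B,
      forall x : H, `|x| <= B -> q x != ord_max -> `|x - y (q x)| <= 2 * eta &
      law mu q ord_max <= eta].
Proof.
move=> B0 eta0; have [s ds] := dense_sequence.
pose A i : set (borel H) := ball (s i) eta.
have mA i : measurable (A i) by apply: measurable_open; exact: ball_open.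
pose N Q : set (borel H) := \bigcap_(i in `I_Q) ~` A i.
have mN Q : measurable (N Q).
  apply: fin_bigcap_measurable => [|i _]; last exact: measurableC.
  exact: finite_II.
have N0 : \bigcap_Q N Q = set0.
  apply/seteqP; split=> // x Nx.
  have [z [bz [i _ si]]] := ds (ball (x : H) eta) (ex_intro _ _ (ballxx (x : H) eta0)) (ball_open (x : H) eta).
  apply: (Nx i.+1 I i (ltnSn i)); rewrite /A si.
  exact: ball_sym.
have [Q muQ] : exists Q, (mu (N Q) <= eta%:E)%E.
  have cv : (mu \o N) @ \oo --> mu (\bigcap_Q N Q).
    apply: nonincreasing_cvg_mu => //.
    - exact: le_lt_trans (probability_le1 mu (mN 0%N)) (ltry _).
    - by rewrite N0.
    - move=> m m' mm'; apply/subsetPset => x Nx i im; apply: Nx.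
      exact: leq_trans mm'.
  rewrite N0 measure0 in cv.
  apply: contrapT => /forallNP h.
  have : (eta%:E <= limn (mu \o N))%E.
    apply: lime_ge; first by apply/cvg_ex; eexists; exact: cv.
    by apply: nearW => Q; rewrite leNgt; apply/negP => /ltW; exact: h.
  by rewrite (cvg_lim _ cv)// lee_fin leNgt eta0.
pose idx (x : borel H) := find (fun i => `[< A i x >]) (iota 0 Q).
have idxQ x : (idx x < Q.+1)%N by rewrite ltnS -[Q in (_ <= Q)%N](size_iota 0) find_size.
pose q x : 'I_Q.+1 := Ordinal (idxQ x).
have idx_ge x j : (j <= Q)%N -> (j <= idx x)%N <-> N j x.
  move=> jQ; split.
    move=> ji i ij; apply/asboolPn; have iQ : (i < Q)%N by exact: leq_trans jQ.
    have := @before_find _ 0%N (fun i => `[< A i x >]) (iota 0 Q) i.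
    by rewrite nth_iota// add0n => ->//; exact: leq_trans ji.
  move=> Nx; rewrite leqNgt; apply/negP => idxj.
  have hs : has (fun i => `[< A i x >]) (iota 0 Q).
    by rewrite has_find size_iota; exact: leq_trans jQ.
  have := nth_find 0%N hs; rewrite nth_iota ?add0n; last first.
    by move: hs; rewrite has_find size_iota.
  by move/asboolP; exact: Nx.
have qN j : q @^-1` [set j] = N j `\` (if (j < Q)%N then N j.+1 else set0).
  have jQ : (j <= Q)%N by rewrite -ltnS; exact: ltn_ord.
  apply/seteqP; split=> x.
    move=> /(congr1 val)/= xj; split; first by apply/idx_ge => //; rewrite xj.
    by case: ifPn => [jQ' /(idx_ge _ _ jQ')|_ []]; rewrite xj ltnn.
  move=> [Nj Nj1]; apply/val_inj/eqP; rewrite eqn_leq.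
  rewrite [X in _ && X](iffRL (idx_ge x j jQ) Nj) andbT leqNgt; apply/negP => lt.
  case: ifPn Nj1 => jlt; last by move: (idxQ x) jlt; rewrite /= ltnS => h; rewrite (leq_trans lt h).
  by apply; apply/idx_ge.
pose y j : H := xget 0 [set x : H | `|x| <= B /\ q x = j].
exists Q, q, y; split.
- move=> j; rewrite qN; apply: measurableD => //.
  by case: ifP => _ //; exact: measurable0.
- by move=> j; rewrite /y; case: xgetP => [x _ []//|_]; rewrite normr0.
- move=> x xB qx.
  have near z : q z = q x -> `|z - s (q x)| < eta.
    move=> /(congr1 val)/= zx.
    have xQ : (idx z < Q)%N.
      rewrite zx ltn_neqAle -ltnS idxQ andbT; apply: contraNneq qx => e.
      exact/eqP/val_inj.
    have hs : has (fun i => `[< A i z >]) (iota 0 Q) by rewrite has_find size_iota.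
    have := nth_find 0%N hs; rewrite nth_iota// add0n -/(idx z) => /asboolP.
    by rewrite /A -ball_normE/= zx distrC.
  have [xy qy] : `|y (q x)| <= B /\ q (y (q x)) = q x.
    by rewrite /y; case: xgetP => [z -> //|/(_ x)/= h]; exfalso; apply: h.
  rewrite -[x - _](subrKA (s (q x))).
  apply: le_trans (ler_normD _ _) _.
  have := near x erefl; have := near _ qy; rewrite distrC; lra.
- rewrite -lee_fin lawE; last first.
    by move=> j; rewrite qN; apply: measurableD => //; case: ifP => _ //; exact: measurable0.
  by rewrite qN/= ltnn setD0.
Qed.

End quantizer.

(** * Transfer to arbitrary laws on the ball *)

Section transfer.
Context (R : realType) (H : completeNormedModType R).

Lemma continuous_borel_measurable (f : H -> R) : continuous f ->
  measurable_fun setT (f : borel H -> R).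
Proof.
move=> cf; apply: (measurability _ (RGenOInfty.measurableE R)) => //.
move=> _ [_ [x ->] <-]; rewrite setTI; apply: measurable_open.
by apply: open_comp => // y _; exact: cf.
Qed.

Context (Hsep : separable H) (d : measure_display) (Omega : measurableType d)
  (P : probability Omega R) (n : nat) (n0 : (0 < n)%N) (B : R) (B0 : 0 <= B)
  (X : {RV P >-> borel H}) (Xs : 'I_n -> {RV P >-> borel H})
  (hX : independent_copies X Xs) (HB : P [set w | `|X w : H| <= B] = 1%E).

Let mu : probability (borel H) R := distribution P X.

Definition centered_ball : set (borel H) := [set x | `|x : H| <= B].

Lemma measurable_centered_ball : measurable centered_ball.
Proof.
have -> : centered_ball = ~` [set x : H | B < `|x|].
  by apply/seteqP; split=> x /=; rewrite /centered_ball/= leNgt => /negP.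
apply: (@measurableC _ (borel H)); apply: (@measurable_open R H).
have /continuousP h := @norm_continuous R H.
exact: (h _ (@open_gt R B)).
Qed.

Lemma centered_ball1 : mu centered_ball = 1%E. Proof. exact: HB. Qed.

Lemma ae_sample_in_ball : {ae P, forall w, forall i, `|Xs i w : H| <= B}.
Proof.
have h i : P (Xs i @^-1` (~` centered_ball)) = 0%E.
  have mC := measurableC measurable_centered_ball.
  apply: (etrans (hX.2 i _ mC)).
  by apply: (etrans (probability_setC mu measurable_centered_ball)); rewrite centered_ball1 subee.
apply: filter_forall => i; exists (Xs i @^-1` (~` centered_ball)); split.
- by apply: measurable_funPTI; apply: measurableC; exact: measurable_centered_ball.
- exact: h.
- by move=> w.
Qed.

Context (C : Type) (S : set C) (S0 : S !=set0) (phi : C -> H -> R)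
  (ell b K : R) (ell0 : 0 <= ell) (b0 : 0 <= b).
Context
  (mphi : forall c, S c -> measurable_fun setT (phi c : borel H -> R))
  (lip : forall c, S c -> forall x y : H, `|x| <= B -> `|y| <= B ->
     `|phi c x - phi c y| <= ell * `|x - y|)
  (osc : forall c, S c -> forall x y : H, `|x| <= B -> `|y| <= B ->
     phi c x - phi c y <= b)
  (finK : forall (T : finType) (p : T -> R) (y : T -> H), is_dist p ->
     (forall j, `|y j| <= B) -> forall c : n.-tuple T -> C, (forall t, S (c t)) ->
     mean (@iid R T n p) (fun t => gap p t (fun x => phi (c t) (y x))) <= K).

Let sample (w : Omega) : 'I_n -> H := fun i => Xs i w.

(** The points of the sample and the law are moved to finitely many points; the
    error [e] this makes is small in mean, uniformly over the class. *)
Lemma finite_approximation (xi : R) : 0 < xi ->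
  exists (T : finType) (t : Omega -> n.-tuple T) (Z e : n.-tuple T -> R),
  [/\ forall s, measurable (t @^-1` [set s]),
      {ae P, forall w, forall c, S c ->
        (mean_gap mu (sample w) (phi c) <= (Z (t w) + e (t w))%:E)%E},
      (forall s, 0 <= e s) /\ mean (law P t) e <= xi,
      mean (law P t) Z <= K &
      forall delta, 0 < delta < 1 ->
        1 - delta <= \sum_(s | Z s <= K + b * Num.sqrt (ln delta^-1 / (2 * n%:R)))
          law P t s].
Proof.
move=> xi0; pose eta := xi / (4 * (1 + B) * (1 + ell)).
have D0 : 0 < 4 * (1 + B) * (1 + ell) by rewrite !mulr_gt0// ltr_pwDl.
have eta0 : 0 < eta by rewrite divr_gt0.
have [Q [q [y [mq yB yq qQ]]]] := quantizer Hsep mu B0 eta0.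
set p := law mu q in qQ *.
have hp : is_dist p by exact: law_dist mq.
pose r (j : 'I_Q.+1) : R := 2 * eta + 2 * B * (j == ord_max)%:R.
have r0 j : 0 <= r j.
  by apply: addr_ge0; [rewrite mulr_ge0// ltW|rewrite !mulr_ge0].
have xyr (x : H) : `|x| <= B -> `|x - y (q x)| <= r (q x).
  move=> xB; rewrite /r; case: eqVneq => [->|qx].
    apply: le_trans (ler_normB _ _) _.
    by rewrite mulr1; have := yB ord_max; lra.
  by rewrite mulr0 addr0 yq.
have mr : mean p r <= 2 * eta * (1 + B).
  rewrite meanD mean_cst// meanZ /mean (bigD1 ord_max)//= eqxx mulr1 big1 ?addr0.
    have : 2 * B * p ord_max <= 2 * B * eta by rewrite ler_wpM2l// mulr_ge0.
    lra.
  by move=> j /negPf ->; rewrite mulr0.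
pose t := quantized_sample Xs q.
pose e (s : n.-tuple 'I_Q.+1) := ell * (mean p r + n%:R^-1 * \sum_(i < n) r (tnth s i)).
have lawt : law P t = iid p by apply/funext => s; exact: (law_quantized_sample hX mq).
have [Z [Z_ge Z_mean Z_tail]] :=
  @uniform_deviation R 'I_Q.+1 n n0 p hp C S (fun c j => phi c (y j)) b K S0 b0
    (fun c Sc i j => osc Sc (yB i) (yB j)) (@finK _ p y hp yB).
exists 'I_Q.+1, t, Z, e; split.
- by move=> s; exact: (measurable_quantized_sample Xs mq).
- apply: filterS ae_sample_in_ball => w wB c Sc.
  have near x : centered_ball x -> `|phi c x - phi c (y (q x))| <= ell * r (q x).
    move=> xB; apply: le_trans (lip Sc xB (yB _)) _.
    by rewrite ler_wpM2l// xyr.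
  have [_ [I II Ip]] := @integral_approx _ (borel H) R mu _ q mq _
    measurable_centered_ball centered_ball1 _ (mphi Sc) (fun j => phi c (y j))
    (fun j => ell * r j) (fun j => mulr_ge0 ell0 (r0 j)) near.
  rewrite /mean_gap /population_mean II -EFinB lee_fin.
  apply: (@le_trans _ _ (gap p (t w) (fun j => phi c (y j)) + e (t w))); last first.
    by rewrite lerD2r Z_ge.
  have nV : 0 <= n%:R^-1 :> R by rewrite invr_ge0.
  have emp : n%:R^-1 * \sum_(i < n) phi c (y (tnth (t w) i)) <=
      empirical_mean (sample w) (phi c) +
      ell * (n%:R^-1 * \sum_(i < n) r (tnth (t w) i)).
    rewrite /empirical_mean mulrCA -mulrDr ler_wpM2l// mulr_sumr -big_split/=.
    apply: ler_sum => i _; rewrite tnth_mktuple.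
    by have := near _ (wB i); rewrite ler_norml => /andP[]; rewrite /sample; lra.
  have : I <= mean p (fun j => phi c (y j)) + ell * mean p r.
    by move: Ip; rewrite ler_norml => /andP[_]; rewrite meanZ; lra.
  rewrite /gap /e; lra.
- split=> [s|].
    rewrite mulr_ge0// addr_ge0//; first exact: mean_ge.
    by rewrite mulr_ge0 ?invr_ge0// sumr_ge0.
  rewrite lawt; have hi := iid_dist n hp.
  have -> : mean (@iid R _ n p) e = 2 * ell * mean p r.
    have := mean_gap0 r hp n0; rewrite /gap meanB mean_cst// => /subr0_eq h.
    by rewrite meanZ meanD mean_cst// -h; ring.
  have : 2 * ell * mean p r <= 2 * ell * (2 * eta * (1 + B)).
    by rewrite ler_wpM2l// mulr_ge0.
  move=> /le_trans; apply.
  have -> : xi = eta * (4 * (1 + B) * (1 + ell)) by rewrite /eta divfK// gt_eqF.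
  have : 0 <= eta * (1 + B) by rewrite mulr_ge0 ?addr_ge0// ltW.
  lra.
- by rewrite lawt.
- by rewrite lawt.
Qed.

(** The error of the approximation exceeds [v] with probability at most [v] when
    its mean is at most [v ^+ 2]; then [v] tends to [0]. *)
Lemma sup_mean_gap_deviation (delta : R) : 0 < delta < 1 ->
  with_probability_ge P (1 - delta) [set w |
    (ereal_sup [set mean_gap mu (sample w) (phi c) | c in S] <=
      (K + b * Num.sqrt (ln delta^-1 / (2 * n%:R)))%:E)%E].
Proof.
move=> d01; set L := K + _.
pose F m := [set w | (ereal_sup [set mean_gap mu (sample w) (phi c) | c in S] <=
  (L + m.+1%:R^-1)%:E)%E].
apply: (@with_probability_ge_limit _ _ _ _ _ F); last first.
  move=> w Fw; apply/lee_addgt0Pr => e e0.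
  have [m Nm Fm] := Fw (Num.truncn e^-1).
  apply: le_trans Fm _; rewrite -EFinD lee_fin lerD2l.
  rewrite invf_ple ?posrE//; apply: ltW; apply: lt_le_trans (truncnS_gt _) _.
  by rewrite ler_nat ltnS.
move=> m; set v := m.+1%:R^-1; have v0 : 0 < v by rewrite invr_gt0.
have [T [t [Z [e [mt [N [mN N0 NP]] [e0 e_mean] _ Z_tail]]]]] :=
  @finite_approximation (v ^+ 2) (exprn_gt0 _ v0).
have hl : is_dist (law P t) by exact: law_dist mt.
pose good s := (Z s <= L) && (e s <= v).
exists (t @^-1` [set s | good s] `\` N); split.
- by apply: measurableD => //; exact: measurable_preimage mt _.
- move=> w [/andP[Zs es] Nw]; rewrite /F/=; apply: ge_ereal_sup => _ [c Sc <-].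
  have h : forall c, S c ->
      (mean_gap mu (sample w) (phi c) <= (Z (t w) + e (t w))%:E)%E.
    by apply: contrapT => h; apply: Nw; apply: NP.
  by apply: le_trans (h c Sc) _; rewrite lee_fin lerD.
- have mA := measurable_preimage mt [set s | good s].
  apply: (@le_trans _ _ (P (t @^-1` [set s | good s]))); last first.
    have AN0 : P (t @^-1` [set s | good s] `&` N) = 0%E.
      by apply: (subset_measure0 _ _ _ N0) => //; exact: measurableI.
    by rewrite [leLHS](measureDI P mA mN) [X in (_ + X)%E]AN0 adde0.
  rewrite [leRHS](measure_preimage P mt good) lee_fin.
  apply: le_trans (lerB (Z_tail _ d01) (le_trans (markov_le hl e0 v0) _)) _.
    by rewrite ler_pdivrMr// -expr2; exact: e_mean.
  rewrite lerBlDr [leLHS](bigID (fun s => e s <= v))/= lerD//.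
  rewrite [leLHS]big_mkcond [leRHS]big_mkcond; apply: ler_sum => s _.
  by rewrite ltNge; case: (e s <= v); case: (Z s <= _) => //=; exact: hl.1.
Qed.

Lemma mean_gap_integrable_bound (xi : R) : 0 < xi ->
  exists W : Omega -> R,
  [/\ P.-integrable setT (EFin \o W), (\int[P]_w (W w)%:E <= (K + xi)%:E)%E &
      {ae P, forall w, forall c, S c ->
        (mean_gap mu (sample w) (phi c) <= (W w)%:E)%E}].
Proof.
move=> xi0.
have [T [t [Z [e [mt ZP [_ e_mean] Z_mean _]]]]] := finite_approximation xi0.
exists (fun w => Z (t w) + e (t w)); split=> //.
  exact: (integrable_finite P mt (fun s => Z s + e s)).
by rewrite (integral_finite P mt (fun s => Z s + e s)) lee_fin meanD lerD.
Qed.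

End transfer.

(** * The quantization losses *)

Section losses.
Context (R : realType) (H : completeNormedModType R) (ip : {dot H for idfun})
  (Hip : norm_induced_by ip) (k : nat) (k0 : (0 < k)%N).
Implicit Types (c : 'I_k -> H) (x y : H) (M : R).

Lemma linear_loss_lipschitz M c x y : ball_tuples k M c ->
  `|linear_loss ip c x - linear_loss ip c y| <= 2 * M * `|x - y|.
Proof.
move=> cM; have [j h] := dist_min_family k0 (fun j => `|c j| ^+ 2 - 2 * ip (c j) x)
                                            (fun j => `|c j| ^+ 2 - 2 * ip (c j) y).
apply: le_trans h _.
have -> : `|c j| ^+ 2 - 2 * ip (c j) x - (`|c j| ^+ 2 - 2 * ip (c j) y) =
    - (2 * ip (c j) (x - y)) by rewrite ipBr; ring.
rewrite normrN normrM ger0_norm// -mulrA ler_pM2l//.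
by apply: le_trans (abs_ip_le Hip _ _) _; rewrite ler_wpM2r.
Qed.

Lemma linear_loss_bounds M c x : ball_tuples k M c -> `|x| <= M ->
  - M ^+ 2 <= linear_loss ip c x <= 3 * M ^+ 2.
Proof.
move=> cM xM; rewrite /linear_loss; have [j ->] := min_family_attained k0 (fun j => `|c j| ^+ 2 - 2 * ip (c j) x).
have M0 : 0 <= M by apply: le_trans xM.
have x2 : `|x| ^+ 2 <= M ^+ 2 by rewrite ler_sqr ?nnegrE.
have c2 : `|c j| ^+ 2 <= M ^+ 2 by rewrite ler_sqr ?nnegrE//; exact: cM.
have : 0 <= `|x - c j| ^+ 2 by exact: sqr_ge0.
have : 0 <= `|x + c j| ^+ 2 by exact: sqr_ge0.
by rewrite (sqr_normD Hip) (sqr_normB Hip) (ipC ip (c j)) => *; apply/andP; split; lra.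
Qed.

(** The term [`|x| ^+ 2] is common to all centres and cancels in differences of
    quadratic losses. *)
Lemma quadratic_lossE c x : quadratic_loss c x = `|x| ^+ 2 + linear_loss ip c x.
Proof.
rewrite /linear_loss -[X in _ + X]mul1r -min_family_affine//.
congr min_family; apply/funext => j.
by rewrite (sqr_normB Hip) (ipC ip x); ring.
Qed.

Lemma quadratic_loss_ge0 c x : 0 <= quadratic_loss c x.
Proof. by apply: min_family_ge => // j; exact: sqr_ge0. Qed.

Lemma measurable_linear_loss c :
  measurable_fun setT (linear_loss ip c : borel H -> R).
Proof.
apply: continuous_borel_measurable => x; apply/cvgrPdist_le => e e0.
pose M := 1 + \sum_j `|c j|.
have M0 : 0 < M by rewrite ltr_pwDl// sumr_ge0.
have cM : ball_tuples k M c.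
  move=> j; rewrite /M (bigD1 j)//= addrCA lerDl addr_ge0//.
  exact: sumr_ge0.
have e1 : 0 < e / (2 * M) by rewrite divr_gt0// mulr_gt0.
near=> y; apply: le_trans (linear_loss_lipschitz _ _ cM) _.
rewrite -ler_pdivlMl ?mulr_gt0// mulrC.
by near: y; apply: cvgr_dist_le.
Unshelve. all: by end_near. Qed.

Lemma measurable_quadratic_loss c :
  measurable_fun setT (quadratic_loss c : borel H -> R).
Proof.
have -> : quadratic_loss c = (fun x => `|x| ^+ 2 + linear_loss ip c x).
  by apply/funext => x; exact: quadratic_lossE.
apply: (@measurable_funD _ (borel H)); last exact: measurable_linear_loss.
apply: (@measurable_funX _ (borel H)).
apply: continuous_borel_measurable; exact: norm_continuous.
Qed.

(** The radial projection on the ball, which is the metric projection. *)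
Definition clip M x : H := if `|x| <= M then x else (M / `|x|) *: x.

Lemma clip_le M x : 0 <= M -> `|clip M x| <= M.
Proof.
move=> M0; rewrite /clip; case: ifPn => //; rewrite -ltNge => xM.
have x0 : 0 < `|x| by apply: le_lt_trans xM.
by rewrite normrZ ger0_norm ?divr_ge0// divfK// gt_eqF.
Qed.

Lemma dist_clip_le M x y : `|x| <= M -> `|x - clip M y| ^+ 2 <= `|x - y| ^+ 2.
Proof.
move=> xM; have M0 : 0 <= M by exact: le_trans xM.
rewrite /clip; case: ifPn => //; rewrite -ltNge => yM.
have y0 : 0 < `|y| by apply: le_lt_trans yM.
set s := M / `|y|.
have sy : s * `|y| = M by rewrite divfK// gt_eqF.
have s0 : 0 <= s by rewrite divr_ge0.
have s1 : s <= 1 by rewrite ler_pdivrMr// mul1r ltW.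
rewrite !(sqr_normB Hip) (ipZr ip) normrZ ger0_norm// sy.
have := ip_le Hip x y => h.
have h2 : ip x y <= M * `|y| by apply: le_trans h _; rewrite ler_wpM2r.
have h3 : (1 - s) * ip x y <= (1 - s) * (M * `|y|) by rewrite ler_wpM2l// subr_ge0.
have h4 : s * (M * `|y|) = M ^+ 2 by rewrite mulrCA sy expr2.
have h5 : 0 <= (M - `|y|) ^+ 2 by exact: sqr_ge0.
nra.
Qed.

Lemma quadratic_loss_clip M c x : `|x| <= M ->
  quadratic_loss (fun j => clip M (c j)) x <= quadratic_loss c x.
Proof. by move=> xM; apply: le_min_family => // j; exact: dist_clip_le. Qed.

End losses.

Section selectors.
Context (R : realType) (H : completeNormedModType R) (ip : {dot H for idfun})
  (Hip : norm_induced_by ip) (n k : nat) (k2 : (2 <= k)%N) (nk : (2 * k <= n)%N)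
  (B : R) (B0 : 0 <= B).

Let k0 : (0 < k)%N. Proof. exact: ltn_trans k2. Qed.

Let n0 : (0 < n)%N. Proof. by apply: leq_trans nk; rewrite muln_gt0. Qed.

Definition mean_bound := Num.min (B ^+ 2 * rate R n k * sharp_factor R n k)
                                 (16 * B ^+ 2 * rate R n k).

Lemma linear_loss_osc c (x y : H) : ball_tuples k B c -> `|x| <= B -> `|y| <= B ->
  linear_loss ip c x - linear_loss ip c y <= 4 * B ^+ 2.
Proof.
move=> cB xB yB; have /andP[_ h1] := linear_loss_bounds Hip k0 cB xB.
have /andP[h2 _] := linear_loss_bounds Hip k0 cB yB; lra.
Qed.

(** When the bound to be proved exceeds [4 * B ^+ 2] it holds because the losses
    have oscillation at most [4 * B ^+ 2]; otherwise it follows from chaining. *)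
Lemma mean_gap_linear_loss_le (T : finType) (p : T -> R) (y : T -> H) :
  is_dist p -> (forall j, `|y j| <= B) -> forall c : n.-tuple T -> 'I_k -> H,
  (forall t, ball_tuples k B (c t)) ->
  mean (@iid R T n p) (fun t => gap p t (fun x => linear_loss ip (c t) (y x)))
    <= mean_bound.
Proof.
move=> hp yB c cB.
have trivial_bound : mean (@iid R T n p)
    (fun t => gap p t (fun x => linear_loss ip (c t) (y x))) <= 4 * B ^+ 2.
  apply: mean_le => [|t]; first exact: iid_dist.
  by apply: gap_le_oscillation => // i j; exact: linear_loss_osc.
have [B00|Bn0] := eqVneq B 0.
  apply: le_trans trivial_bound _.
  by rewrite /mean_bound B00 expr0n/= !mulr0 !mul0r minxx.
have B_gt0 : 0 < B by rewrite lt0r Bn0.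
have B2 : 0 <= B ^+ 2 by exact: sqr_ge0.
have first_bound : mean (@iid R T n p)
    (fun t => gap p t (fun x => linear_loss ip (c t) (y x)))
    <= B ^+ 2 * rate R n k * sharp_factor R n k.
  have [e8|/ltW e8] := leP (8 * ln 2 : R) (ln (n%:R / k%:R)).
    have [N nN bound] := chain_bound_le_rate k2 nk e8.
    apply: le_trans (mean_gap_linear_le Hip k2 n0 hp B_gt0 yB cB nN) _.
    by rewrite -[leRHS]mulrA ler_wpM2l.
  apply: le_trans trivial_bound _.
  by rewrite -[leRHS]mulrA [4 * _]mulrC ler_wpM2l//; exact: rate_sharp_ge4.
rewrite /mean_bound le_min first_bound/=.
have rate0 : 0 <= rate R n k.
  apply: mulr_ge0; last exact: sqrtr_ge0.
  rewrite ln_ge0// ler_pdivlMr ?ltr0n// mul1r ler_nat.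
  by apply: leq_trans nk; exact: leq_pmull.
have [r4|/ltW r4] := leP (16 * rate R n k) 4.
  apply: le_trans first_bound _.
  have := sharp_factor_le k2 nk r4 => h.
  have : 0 <= B ^+ 2 * rate R n k by rewrite mulr_ge0.
  nra.
by apply: le_trans trivial_bound _; nra.
Qed.

Lemma deviationE (delta : R) (M : R) : 0 < delta < 1 ->
  2 * M * Num.sqrt (ln delta^-1 / (2 * n%:R)) = M * deviation n delta.
Proof.
move=> d01; have nR : 0 < n%:R :> R by rewrite ltr0n.
rewrite /deviation.
have -> : 2 * ln delta^-1 / n%:R = 2 ^+ 2 * (ln delta^-1 / (2 * n%:R)) :> R.
  by field; rewrite gt_eqF.
by rewrite [in RHS]sqrtrM ?sqr_ge0// sqrtr_sqr ger0_norm// mulrA [M * 2]mulrC.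
Qed.

End selectors.

Section integral_without_measurability.
Import HBNNSimple.
Context (d : measure_display) (Omega : measurableType d) (R : realType)
  (P : probability Omega R).

(** The integral of a nonnegative function is a supremum over simple functions
    below it, so that only the upper bound has to be measurable. *)
Lemma integral_le_integrable (f : Omega -> \bar R) (g : Omega -> R) :
  (forall w, 0 <= f w)%E -> P.-integrable setT (EFin \o g) ->
  {ae P, forall w, (f w <= (g w)%:E)%E} ->
  (\int[P]_w f w <= \int[P]_w (g w)%:E)%E.
Proof.
move=> f0 ig fg.
have mg : measurable_fun setT (EFin \o g) by case/integrableP: ig.
have mgp := measurable_funepos mg.
have -> : (\int[P]_w (g w)%:E = \int[P]_w ((EFin \o g)^\+ w))%E.
  apply: ae_eq_integral => //.
  apply: filterS fg => w fgw _ /=; rewrite funeposE.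
  by apply/esym/max_idPl; exact: le_trans (f0 w) fgw.
rewrite ge0_integralTE//; apply: ge_ereal_sup => _ [h hf <-].
rewrite -integralT_nnsfun; apply: ae_ge0_le_integral => //.
- by move=> w _; rewrite lee_fin; exact: fun_ge0.
- exact/measurable_EFinP.
- apply: filterS fg => w fgw _ /=; rewrite funeposE le_max.
  by rewrite (le_trans (hf w) fgw).
Qed.

End integral_without_measurability.

(** * Excess risk *)

Section excess_risk.
Context (R : realType) (H : completeNormedModType R) (ip : {dot H for idfun})
  (Hip : norm_induced_by ip) (Hsep : separable H)
  (d : measure_display) (Omega : measurableType d) (P : probability Omega R)
  (n k : nat) (B : R) (X : {RV P >-> borel H}) (Xs : 'I_n -> {RV P >-> borel H})
  (hX : independent_copies X Xs) (HB : P [set w | `|X w : H| <= B] = 1%E)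
  (nk : (2 * k <= n)%N) (k2 : (2 <= k)%N).

Let mu : probability (borel H) R := distribution P X.
Let sample (w : Omega) : 'I_n -> H := fun i => Xs i w.
Let risk (c : 'I_k -> H) := population_mean mu (quadratic_loss c).
Let emp (w : Omega) (c : 'I_k -> H) := empirical_mean (sample w) (quadratic_loss c).
Let K : R := mean_bound n k B.

Let k0 : (0 < k)%N. Proof. exact: ltn_trans k2. Qed.

Let n0 : (0 < n)%N. Proof. by apply: leq_trans nk; rewrite muln_gt0. Qed.

Let B0 : 0 <= B.
Proof.
rewrite leNgt; apply/negP => Bneg; move: HB.
have -> : [set w | `|X w : H| <= B] = set0.
  apply/seteqP; split=> // w /= wB.
  by have := le_lt_trans (le_trans (normr_ge0 _) wB) Bneg; rewrite ltxx.
by rewrite measure0 => /eqP; rewrite eq_sym onee_eq0.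
Qed.

Let ball0 : ball_tuples k B (fun=> 0 : H).
Proof. by move=> j; rewrite normr0. Qed.

Lemma linear_sup_deviation (delta : R) : 0 < delta < 1 ->
  with_probability_ge P (1 - delta) [set w |
    (ereal_sup [set mean_gap mu (sample w) (linear_loss ip c) | c in ball_tuples k B]
      <= (K + 2 * B ^+ 2 * deviation n delta)%:E)%E].
Proof.
move=> d01.
have b0 : 0 <= 4 * B ^+ 2 by rewrite mulr_ge0 ?sqr_ge0.
have ell0 : 0 <= 2 * B by rewrite mulr_ge0.
have := @sup_mean_gap_deviation R H Hsep d Omega P n n0 B B0 X Xs hX HB
  ('I_k -> H) (ball_tuples k B) (ex_intro _ _ ball0) (@linear_loss R H ip k)
  (2 * B) (4 * B ^+ 2) K ell0 b0
  (fun c _ => measurable_linear_loss Hip k0 c)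
  (fun c cB x y _ _ => linear_loss_lipschitz Hip k0 x y cB)
  (fun c cB x y xB yB => linear_loss_osc Hip k2 cB xB yB)
  (mean_gap_linear_loss_le Hip k2 nk B0) delta d01.
have -> : 2 * B ^+ 2 * deviation n delta =
    4 * B ^+ 2 * Num.sqrt (ln delta^-1 / (2 * n%:R)).
  by rewrite -(deviationE k2 nk (2 * B ^+ 2) d01); ring.
by [].
Qed.

(** Subtracting the loss of a fixed reference [cs] adds a centred term to the
    deviations: the mean of the supremum is bounded as before, but the
    oscillation, hence the deviation term, doubles. *)
Section reference.
Context (cs : 'I_k -> H) (csB : ball_tuples k B cs).

Let phi (c : 'I_k -> H) := fun x : H => quadratic_loss c x - quadratic_loss cs x.

Let phiE c x : phi c x = linear_loss ip c x - linear_loss ip cs x.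
Proof. by rewrite /phi !(quadratic_lossE Hip k0); ring. Qed.

Let measurable_phi c : ball_tuples k B c ->
  measurable_fun setT (phi c : borel H -> R).
Proof.
move=> _; apply: (@measurable_funB _ (borel H));
  exact: (measurable_quadratic_loss Hip k0).
Qed.

Let phi_lipschitz c : ball_tuples k B c -> forall x y : H, `|x| <= B ->
  `|y| <= B -> `|phi c x - phi c y| <= 4 * B * `|x - y|.
Proof.
move=> cB x y _ _; rewrite !phiE.
have h1 := linear_loss_lipschitz Hip k0 x y cB.
have h2 := linear_loss_lipschitz Hip k0 x y csB.
set a := linear_loss ip c x in h1 *; set a' := linear_loss ip c y in h1 *.
set e := linear_loss ip cs x in h2 *; set e' := linear_loss ip cs y in h2 *.
have -> : a - e - (a' - e') = (a - a') - (e - e') by ring.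
apply: le_trans (ler_normB _ _) _; lra.
Qed.

Let phi_osc c : ball_tuples k B c -> forall x y : H, `|x| <= B ->
  `|y| <= B -> phi c x - phi c y <= 8 * B ^+ 2.
Proof.
move=> cB x y xB yB; rewrite !phiE.
have := linear_loss_osc Hip k2 cB xB yB.
have := linear_loss_osc Hip k2 csB yB xB; lra.
Qed.

Let phi_mean (T : finType) (p : T -> R) (y : T -> H) : is_dist p ->
  (forall j, `|y j| <= B) -> forall c : n.-tuple T -> 'I_k -> H,
  (forall t, ball_tuples k B (c t)) ->
  mean (@iid R T n p) (fun t => gap p t (fun x => phi (c t) (y x))) <= K.
Proof.
move=> hp yB c cB.
have -> : mean (@iid R T n p) (fun t => gap p t (fun x => phi (c t) (y x))) =
    mean (@iid R T n p) (fun t => gap p t (fun x => linear_loss ip (c t) (y x))).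
  rewrite -[RHS]subr0 -(mean_gap0 (fun x => linear_loss ip cs (y x)) hp n0) -meanB.
  apply: eq_mean => t; rewrite -gapB; apply: eq_gap => x; exact: phiE.
exact: mean_gap_linear_loss_le.
Qed.

Let ell0 : 0 <= 4 * B. Proof. by rewrite mulr_ge0. Qed.
Let b0 : 0 <= 8 * B ^+ 2. Proof. by rewrite mulr_ge0 ?sqr_ge0. Qed.

Lemma quadratic_sup_deviation (delta : R) : 0 < delta < 1 ->
  with_probability_ge P (1 - delta) [set w |
    (ereal_sup [set mean_gap mu (sample w)
        (fun x => quadratic_loss c x - quadratic_loss cs x)%R | c in ball_tuples k B]
      <= (K + 4 * B ^+ 2 * deviation n delta)%:E)%E].
Proof.
move=> d01.
have := @sup_mean_gap_deviation R H Hsep d Omega P n n0 B B0 X Xs hX HB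
  ('I_k -> H) (ball_tuples k B) (ex_intro _ _ ball0) phi
  (4 * B) (8 * B ^+ 2) K ell0 b0 measurable_phi phi_lipschitz phi_osc phi_mean
  delta d01.
have -> : 4 * B ^+ 2 * deviation n delta =
    8 * B ^+ 2 * Num.sqrt (ln delta^-1 / (2 * n%:R)).
  by rewrite -(deviationE k2 nk (4 * B ^+ 2) d01); ring.
by [].
Qed.

Lemma quadratic_integrable_bound (xi : R) : 0 < xi ->
  exists W : Omega -> R,
  [/\ P.-integrable setT (EFin \o W), (\int[P]_w (W w)%:E <= (K + xi)%:E)%E &
      {ae P, forall w, forall c, ball_tuples k B c ->
        (mean_gap mu (sample w)
           (fun x => quadratic_loss c x - quadratic_loss cs x)%R <= (W w)%:E)%E}].
Proof.
exact: (@mean_gap_integrable_bound R H Hsep d Omega P n n0 B B0 X Xs hX HB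
  ('I_k -> H) (ball_tuples k B) (ex_intro _ _ ball0) phi
  (4 * B) (8 * B ^+ 2) K ell0 b0 measurable_phi phi_lipschitz phi_osc phi_mean).
Qed.

End reference.

Lemma integrable_bounded_on_ball (f : H -> R) (M : R) :
  measurable_fun setT (f : borel H -> R) ->
  (forall x : H, `|x| <= B -> `|f x| <= M) -> mu.-integrable setT (EFin \o f).
Proof.
move=> mf fM.
have mq (j : unit) : measurable ((cst tt : borel H -> unit) @^-1` [set j]).
  by rewrite preimage_cst; case: ifP => _; [exact: measurableT|exact: measurable0].
have near (x : borel H) : centered_ball B x -> `|f x - (fun=> 0) tt| <= (fun=> `|M|) tt.
  by move=> xB /=; rewrite subr0; apply: le_trans (fM x xB) (ler_norm _).
by have [] := @integral_approx _ (borel H) R mu unit (fun=> tt) mq _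
  (@measurable_centered_ball R H B) (centered_ball1 HB) f mf (fun=> 0)
  (fun=> `|M|) (fun=> normr_ge0 _) near.
Qed.

Let quadratic_integrable c : ball_tuples k B c ->
  mu.-integrable setT (EFin \o (quadratic_loss c : borel H -> R)).
Proof.
move=> cB; apply: (@integrable_bounded_on_ball _ (4 * B ^+ 2)).
  exact: (measurable_quadratic_loss Hip k0).
move=> x xB; rewrite ger0_norm ?quadratic_loss_ge0// (quadratic_lossE Hip k0).
have /andP[_ h] := linear_loss_bounds Hip k0 cB xB.
have : `|x| ^+ 2 <= B ^+ 2 by rewrite ler_sqr ?nnegrE.
lra.
Qed.

Let riskE c : ball_tuples k B c -> risk c = (fine (risk c))%:E.
Proof.
by move=> cB; rewrite fineK//; apply: integrable_fin_num => //; exact: quadratic_integrable.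
Qed.

Let risk_ge0 c : (0 <= risk c)%E.
Proof. by apply: integral_ge0 => x _; rewrite lee_fin quadratic_loss_ge0. Qed.

Lemma mean_gap_quadratic c c' w : ball_tuples k B c -> ball_tuples k B c' ->
  mean_gap mu (sample w) (fun x => quadratic_loss c x - quadratic_loss c' x)%R =
  (fine (risk c) - fine (risk c') - (emp w c - emp w c'))%:E.
Proof.
move=> cB cB'; rewrite /mean_gap /population_mean.
have -> : empirical_mean (sample w) (fun x => quadratic_loss c x - quadratic_loss c' x)
    = emp w c - emp w c' by rewrite /emp /empirical_mean -mulrBr -sumrB.
rewrite [RHS]EFinB; congr (_ - _)%E.
have := integralB_EFin measurableT (quadratic_integrable cB) (quadratic_integrable cB').
by rewrite EFinB -!riskE// => <-.
Qed.

Lemma risk_clip_le c : (risk (fun j => clip B (c j)) <= risk c)%E.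
Proof.
have mloss (c' : 'I_k -> H) : measurable_fun setT (EFin \o (quadratic_loss c' : borel H -> R)).
  by have h := measurable_quadratic_loss Hip k0 c'; apply/measurable_EFinP.
apply: ae_ge0_le_integral => //.
- by move=> x _; rewrite lee_fin quadratic_loss_ge0.
- exact: mloss.
- by move=> x _; rewrite lee_fin quadratic_loss_ge0.
- exact: mloss.
exists (~` centered_ball B); split.
- by apply: measurableC; exact: measurable_centered_ball.
- by apply: (etrans (probability_setC mu (@measurable_centered_ball R H B)));
    rewrite (centered_ball1 HB) subee.
- move=> x /= h xB; apply: h => _; rewrite lee_fin.
  exact: (quadratic_loss_clip Hip k0).
Qed.

(** The infimum over [H] is approached inside the ball, where risks are finite. *)
Lemma near_minimizer (xi : R) : 0 < xi -> exists2 c, ball_tuples k B c &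
  (risk c <= ereal_inf (range risk) + xi%:E)%E.
Proof.
move=> xi0.
have inf_fin : ereal_inf (range risk) \is a fin_num.
  rewrite ge0_fin_numE; last by apply: le_ereal_inf_tmp => _ [c _ <-].
  apply: (@le_lt_trans _ _ (risk (fun=> 0))); first by apply: ereal_inf_lbound; exists (fun=> 0).
  by rewrite riskE// ltry.
have [_ [c _ <-] h] := lb_ereal_inf_adherent xi0 inf_fin.
exists (fun j => clip B (c j)); first by move=> j; exact: clip_le.
exact: le_trans (risk_clip_le c) (ltW h).
Qed.

Section minimizer.
Context (eps : R) (chat : ('I_n -> H) -> 'I_k -> H)
  (hchat : {ae P, forall w, ball_tuples k B (chat (sample w)) /\
     ((emp w (chat (sample w)))%:E
        <= ereal_inf (range (fun c => (emp w c)%:E)) + eps%:E)%E}).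

Let risk_chat_le (w : Omega) c (v : R) : ball_tuples k B c ->
  ball_tuples k B (chat (sample w)) ->
  ((emp w (chat (sample w)))%:E
        <= ereal_inf (range (fun c => (emp w c)%:E)) + eps%:E)%E ->
  (mean_gap mu (sample w)
     (fun x => quadratic_loss (chat (sample w)) x - quadratic_loss c x)%R <= v%:E)%E ->
  (risk (chat (sample w)) <= risk c + (v + eps)%:E)%E.
Proof.
move=> cB chB hinf; rewrite mean_gap_quadratic// lee_fin => hv.
have : ((emp w (chat (sample w)))%:E <= (emp w c)%:E + eps%:E)%E.
  by apply: le_trans hinf _; rewrite leeD2r//; apply: ereal_inf_lbound; exists c.
rewrite -EFinD lee_fin => he.
by rewrite riskE// [risk c]riskE// -EFinD lee_fin; lra.
Qed.

(** The reference is a near minimizer, which depends on the tolerance: the bounds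
    for all tolerances are combined by [with_probability_ge_limit]. *)
Lemma excess_risk_deviation (delta : R) : 0 < delta < 1 ->
  with_probability_ge P (1 - delta) [set w |
    (risk (chat (sample w)) <= ereal_inf (range risk)
       + (K + 4 * B ^+ 2 * deviation n delta + eps)%:E)%E].
Proof.
move=> d01; set L := K + _.
pose F m := [set w | (risk (chat (sample w)) <=
  ereal_inf (range risk) + (L + eps + m.+1%:R^-1)%:E)%E].
apply: (@with_probability_ge_limit _ _ _ _ _ F); last first.
  move=> w Fw; apply/lee_addgt0Pr => e e0.
  have [m Nm Fm] := Fw (Num.truncn e^-1).
  apply: le_trans Fm _; rewrite -addeA leeD2l// -EFinD lee_fin lerD2l.
  rewrite invf_ple ?posrE//; apply: ltW; apply: lt_le_trans (truncnS_gt _) _.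
  by rewrite ler_nat ltnS.
move=> m; have v0 : 0 < m.+1%:R^-1 :> R by rewrite invr_gt0.
have [c cB hc] := near_minimizer v0.
have [E [mE EA pE]] := quadratic_sup_deviation cB d01.
have [N [mN N0 NP]] := hchat.
exists (E `\` N); split; first exact: measurableD.
  move=> w [Ew Nw].
  have [chB hinf] : ball_tuples k B (chat (sample w)) /\
     ((emp w (chat (sample w)))%:E
        <= ereal_inf (range (fun c => (emp w c)%:E)) + eps%:E)%E.
    by apply: contrapT => h; apply: Nw; apply: NP.
  have hL : (mean_gap mu (sample w)
     (fun x => quadratic_loss (chat (sample w)) x - quadratic_loss c x)%R <= L%:E)%E.
    by apply: le_trans (EA w Ew); apply: ereal_sup_ubound; exists (chat (sample w)).
  apply: le_trans (risk_chat_le cB chB hinf hL) _.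
  have -> : ((L + eps + m.+1%:R^-1)%:E = m.+1%:R^-1%:E + (L + eps)%:E)%E.
    by rewrite -EFinD addrC.
  by rewrite addeA leeD2r.
have EN0 : P (E `&` N) = 0%E.
  by apply: (subset_measure0 _ _ _ N0) => //; exact: measurableI.
have : (P E <= P (E `\` N))%E.
  by rewrite [leLHS](measureDI P mE mN) [X in (_ + X)%E]EN0 adde0.
by apply: le_trans; apply: le_trans pE; rewrite lee_fin gerBl ltW.
Qed.

Lemma excess_risk_mean :
  (\int[P]_w risk (chat (sample w)) <= ereal_inf (range risk) + (K + eps)%:E)%E.
Proof.
apply/lee_addgt0Pr => e e0.
have e2 : 0 < e / 2 by rewrite divr_gt0.
have [c cB hc] := near_minimizer e2.
have [W [iW mW hW]] := quadratic_integrable_bound cB e2.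
pose g w := fine (risk c) + eps + W w.
have ig : P.-integrable setT (EFin \o g).
  have -> : EFin \o g = (fun w => (cst (fine (risk c) + eps)%:E w + (EFin \o W) w)%E).
    by apply/funext.
  by apply: integrableD => //; exact: finite_measure_integrable_cst.
apply: (@le_trans _ _ (\int[P]_w (g w)%:E)%E).
  apply: integral_le_integrable => //.
  apply: filterS2 hchat hW => w [chB hinf] /(_ _ chB) hw.
  apply: le_trans (risk_chat_le cB chB hinf hw) _.
  by rewrite riskE// -EFinD lee_fin /g; lra.
have -> : (\int[P]_w (g w)%:E = (fine (risk c) + eps)%:E + \int[P]_w (W w)%:E)%E.
  rewrite -[X in (X + _)%E]mule1 -(probability_setT P) -integral_cst//.
  rewrite -integralD//; exact: finite_measure_integrable_cst.
apply: (@le_trans _ _ ((fine (risk c) + eps)%:E + (K + e / 2)%:E)%E).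
  by rewrite leeD2l.
apply: (@le_trans _ _ (risk c + (K + eps + e / 2)%:E)%E).
  by rewrite [in leRHS]riskE// -!EFinD lee_fin; lra.
apply: le_trans (leeD2r _ hc) _.
by rewrite -!addeA leeD2l// -!EFinD lee_fin; lra.
Qed.

End minimizer.

End excess_risk.

Theorem proposition18 (R : realType) (H : completeNormedModType R)
  (ip : {dot H for idfun}) (Hip : norm_induced_by ip) (Hsep : separable H)
  (d : measure_display) (Omega : measurableType d) (P : probability Omega R)
  (n k : nat) (B : R) (X : {RV P >-> borel H})
  (Xs : 'I_n -> {RV P >-> borel H})
  (Hcopies : independent_copies X Xs)
  (HB : P [set w | `|X w : H| <= B] = 1%E)
  (Hn : (2 * k <= n)%N) (Hk : (2 <= k)%N) :
  let PX : probability (borel H) R := distribution P X in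
  let sample (w : Omega) : 'I_n -> H := fun i => Xs i w in
  let risk (c : 'I_k -> H) := population_mean PX (quadratic_loss c) in
  let emp_risk (w : Omega) (c : 'I_k -> H) :=
    empirical_mean (sample w) (quadratic_loss c) in
  [/\ (* (1) *)
      [/\ forall delta : R, 0 < delta < 1 ->
            with_probability_ge P (1 - delta) [set w |
              let S := ereal_sup [set mean_gap PX (sample w) (linear_loss ip c)
                                 | c in ball_tuples k B] in
              (S <= (B ^+ 2 * rate R n k * sharp_factor R n k
                     + 2 * B ^+ 2 * deviation n delta)%:E)%E /\
              (S <= (16 * B ^+ 2 * rate R n k
                     + 2 * B ^+ 2 * deviation n delta)%:E)%E],
          16 * rate R n k <= 4 -> sharp_factor R n k <= 16
        & 6 * Num.sqrt 2 / ln 2 <= 123 / 10 :> R],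
      (* (2) *)
      forall cs : 'I_k -> H, ball_tuples k B cs ->
        forall delta : R, 0 < delta < 1 ->
          with_probability_ge P (1 - delta) [set w |
            (ereal_sup [set mean_gap PX (sample w)
                              (fun x => quadratic_loss c x - quadratic_loss cs x)%R
                       | c in ball_tuples k B]
             <= (16 * B ^+ 2 * rate R n k
                 + 4 * B ^+ 2 * deviation n delta)%:E)%E]
    & (* (3) and (4) *)
      forall (eps : R) (chat : ('I_n -> H) -> 'I_k -> H), 0 <= eps ->
        {ae P, forall w,
           ball_tuples k B (chat (sample w)) /\
           ((emp_risk w (chat (sample w)))%:E
            <= ereal_inf (range (fun c => (emp_risk w c)%:E)) + eps%:E)%E} ->
        (forall delta : R, 0 < delta < 1 ->
          with_probability_ge P (1 - delta) [set w |
            (risk (chat (sample w))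
             <= ereal_inf (range risk)
                + (16 * B ^+ 2 * rate R n k
                   + 4 * B ^+ 2 * deviation n delta + eps)%:E)%E]) /\
        (\int[P]_w risk (chat (sample w))
           <= ereal_inf (range risk)
              + (16 * B ^+ 2 * rate R n k + eps)%:E)%E].
Proof.
move=> PX sample risk emp_risk.
have mb1 : mean_bound n k B <= B ^+ 2 * rate R n k * sharp_factor R n k.
  by rewrite /mean_bound ge_min lexx.
have mb2 : mean_bound n k B <= 16 * B ^+ 2 * rate R n k.
  by rewrite /mean_bound ge_min lexx orbT.
split.
- split.
  + move=> delta d01.
    apply: with_probability_geS (linear_sup_deviation Hip Hsep Hcopies HB Hn Hk d01).
    by move=> w /= h; split; apply: le_trans h _; rewrite lee_fin lerD2r.
  + exact: sharp_factor_le.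
  + exact: leading_constant_le.
- move=> cs csB delta d01.
  apply: with_probability_geS (quadratic_sup_deviation Hip Hsep Hcopies HB Hn Hk csB d01).
  by move=> w /= h; apply: le_trans h _; rewrite lee_fin lerD2r.
- move=> eps chat eps0 hchat; split=> [delta d01|].
  + apply: with_probability_geS (excess_risk_deviation Hip Hsep Hcopies HB Hn Hk hchat d01).
    by move=> w /= h; apply: le_trans h _; rewrite leeD2l// lee_fin !lerD2r.
  + apply: le_trans (excess_risk_mean Hip Hsep Hcopies HB Hn Hk hchat) _.
    by rewrite leeD2l// lee_fin lerD2r.
Qed.
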